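(* Let $1\le p_0,p_1,q_0,q_1\le\infty$, where $\ell_\infty$ is replaced by $c_0$ wherever it appears (i.e. $\ell_{q_i}$ means $c_0$ when $q_i=\infty$). Then the couple $\big(\widetilde H^{p_0}(\ell_{q_0}),\widetilde H^{p_1}(\ell_{q_1})\big)$ is K-closed with respect to $\big(L_{p_0}(\ell_{q_0}),L_{p_1}(\ell_{q_1})\big)$, i.e. there is a constant $C$ such that for all $t>0$ and all $x\in \widetilde H^{p_0}(\ell_{q_0})+\widetilde H^{p_1}(\ell_{q_1})$, $$K_t\big(x,\widetilde H^{p_0}(\ell_{q_0}),\widetilde H^{p_1}(\ell_{q_1})\big)\le C\,K_t\big(x,L_{p_0}(\ell_{q_0}),L_{p_1}(\ell_{q_1})\big).$$
   Context: $\mathbf T$ is the unit circle with normalized Haar measure $m$. For a Banach space $B$ and $1\le p\le\infty$, $L_p(B)$ is the Bochner space of $B$-valued $p$-integrable functions on $(\mathbf T,m)$, and $\widetilde H^p(B)$ is the closure in $L_p(B)$ of $\mathcal T\otimes B$, where $\mathcal T$ is the span of $\{e^{ikt}:k\ge0\}$. $K_t(x,A_0,A_1)=\inf\{\|x_0\|_{A_0}+t\|x_1\|_{A_1}:x=x_0+x_1,\ x_i\in A_i\}$. *)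

(* Defs.v *)
From HB Require Import structures.
From mathcomp Require Import all_boot all_order all_algebra.
From mathcomp Require Import all_classical all_reals all_analysis.
From mathcomp Require Import complex.
Set Implicit Arguments. Unset Strict Implicit. Unset Printing Implicit Defensive.
Import Order.TTheory GRing.Theory Num.Theory.
Import numFieldNormedType.Exports.
Local Open Scope classical_set_scope.
Local Open Scope ring_scope.

(* Conventions:
   - The circle T with normalized Haar measure is parametrized by [0,1) with
     Lebesgue measure, via t |-> exp(2 pi i t).
   - Scalars are complex numbers R[i].
   - An element of L_p(ell_q) is represented by F : R -> nat -> R[i]
     (F t is the sequence F(t) in ell_q; values outside [0,1) are irrelevant).
   - Exponents p, q range in \bar R; q = +oo means c_0. *)

Section Defs.
Variable R : realType.

Definition circ : set R := `[0%R, 1%R[.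
Notation mu := (@lebesgue_measure R).

Definition cabs (z : R[i]) : R := Num.sqrt (complex.Re z ^+ 2 + complex.Im z ^+ 2).

Definition expi (k : nat) (t : R) : R[i] :=
  Complex (cos (2 * pi * k%:R * t)) (sin (2 * pi * k%:R * t)).

Definition lq_norm (q : \bar R) (a : nat -> R[i]) : \bar R :=
  match q with
  | EFin r => ((\sum_(0 <= n <oo) ((cabs (a n)) `^ r)%:E) `^ r^-1)%E
  | +oo%E => ereal_sup [set (cabs (a n))%:E | n in setT]
  | -oo%E => 0%E
  end.

Definition in_lq (q : \bar R) (a : nat -> R[i]) : Prop :=
  (lq_norm q a < +oo)%E /\
  (q = +oo%E -> (fun n => cabs (a n)) @ \oo --> 0%R).

Definition Lpq_norm (p q : \bar R) (F : R -> nat -> R[i]) : \bar R :=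
  match p with
  | EFin r => ((\int[mu]_(t in circ) (lq_norm q (F t) `^ r)) `^ r^-1)%E
  | +oo%E => ereal_inf [set M : \bar R |
                        {ae mu, forall t, circ t -> (lq_norm q (F t) <= M)%E}]
  | -oo%E => 0%E
  end.

(* Bochner space L_p(B), B = ell_q (c_0 if q = oo).  Since B is separable and
   the coordinate functionals separate points, strong measurability is
   coordinatewise measurability together with F(t) in B a.e. *)
Definition Lpq (p q : \bar R) (F : R -> nat -> R[i]) : Prop :=
  (forall n, measurable_fun circ (fun t => complex.Re (F t n)) /\
             measurable_fun circ (fun t => complex.Im (F t n))) /\
  {ae mu, forall t, circ t -> in_lq q (F t)} /\
  (Lpq_norm p q F < +oo)%E.

Definition analytic_trig_B (q : \bar R) (G : R -> nat -> R[i]) : Prop :=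
  exists (N : nat) (b : nat -> nat -> R[i]),
    (forall k, in_lq q (b k)) /\
    forall t n, G t n = \sum_(k < N) expi k t * b k n.

Definition Htilde (p q : \bar R) (F : R -> nat -> R[i]) : Prop :=
  Lpq p q F /\
  forall eps : R, 0 < eps -> exists G, analytic_trig_B q G /\
    (Lpq_norm p q (fun t n => (F t n - G t n)%R) < eps%:E)%E.

Definition aeq_circ (F G : R -> nat -> R[i]) : Prop :=
  {ae mu, forall t, circ t -> F t = G t}.

Definition Kfun (p0 q0 p1 q1 : \bar R) (A0 A1 : (R -> nat -> R[i]) -> Prop)
  (t : R) (x : R -> nat -> R[i]) : \bar R :=
  ereal_inf [set v : \bar R | exists x0 x1, A0 x0 /\ A1 x1 /\
     aeq_circ x (fun s n => (x0 s n + x1 s n)%R) /\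
     v = (Lpq_norm p0 q0 x0 + t%:E * Lpq_norm p1 q1 x1)%E].

End Defs.

(* Main.v *)
Require Import Defs.
From HB Require Import structures.
From mathcomp Require Import all_boot all_order all_algebra.
From mathcomp Require Import all_classical all_reals all_analysis.
From mathcomp Require Import measurable_realfun.
From mathcomp Require Import complex.
From mathcomp Require Import ring lra.
Import Order.TTheory GRing.Theory Num.Theory.
Import numFieldNormedType.Exports.
Local Open Scope ring_scope.

(* After approximation, [x] is an analytic polynomial with finitely many
   coordinates G_n, and sampling one good point on each of M short arcs turns a
   decomposition of [x] in the L_p(l_q) spaces into a bound |G_n| <= a0_n + a1_n
   by step functions.  It then suffices to majorize a_i by weights w_i of
   comparable norm such that log w_i, up to a bounded error, is the real part
   of a function of the disc algebra with bounded imaginary part ("BMO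
   regularity"): an analytic cutoff Phi with |Phi| <= C min(1, w1/w0) and
   |1 - Phi| <= C min(1, w0/w1) gives the splitting
   G_n = G_n (1 - Phi_n) + G_n Phi_n.

   If U is analytic with Re U > 0, then log |U| has a bounded conjugate.  Let T
   be the (discretized) analytic projection, which is bounded on l_2 and sends
   positive data to functions with positive real part.  Writing
   a_n = A alpha_n with A the l_q norm of a, the factor A has the majorant
   |T (A^(p/2))|^(2/p), so that only the l_2 bound is used.  For
   sum_n alpha_n^q <= 1 put beta_n = alpha_n^(q/2); a Rubio de Francia iteration
   gives v > 0 with |T v|^2 + sum_n |T (beta_n v)|^2 <= C v^2, and alpha_n has
   the majorant (C |T (beta_n v)| / |T v|)^(2/q). *)

(** * Moduli of complex numbers and the exponentials *)

(** The analytic projection is unbounded on L_1 and on L_infinity, so at the end points it cannot be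
    estimated in the given spaces themselves. Passing to powers [r / 2] moves every estimate to l_2,
    and this is harmless because a power of a weight only rescales the constant in [logreg]. The
    sequence variable is the real difficulty: the l_q norm over n has to be controlled at each point
    of the circle and not on average. One weight v that serves all coordinates at once, with T v
    comparable to v, turns the averaged l_2 bound into a pointwise one.

    All constants are fixed before the grid size M and the number N of coordinates, which makes the
    discretization legitimate. Values of T v at grid points control the whole circle, because T v of
    positive data changes by at most a fixed factor over an arc (a Harnack inequality). Norms are
    added with crude quasi-triangle constants, since C only has to exist. *)

Section ComplexModulus.
Set Implicit Arguments. Unset Strict Implicit. Unset Printing Implicit Defensive.
Local Open Scope classical_set_scope.
Local Open Scope ring_scope.
Variable R : realType.
Implicit Types (x y : R) (z w : R[i]).

Definition rc x : R[i] := Complex x 0.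

Lemma cabs_normc z : cabs z = ComplexField.Normc.normc z.
Proof. by case: z. Qed.

Lemma cabs_ge0 z : 0 <= cabs z. Proof. exact: sqrtr_ge0. Qed.

Lemma cabsM z w : cabs (z * w) = cabs z * cabs w.
Proof. by rewrite !cabs_normc ComplexField.Normc.normcM. Qed.

Lemma cabsV z : cabs z^-1 = (cabs z)^-1.
Proof. by rewrite !cabs_normc ComplexField.Normc.normcV. Qed.

Lemma cabsD z w : cabs (z + w) <= cabs z + cabs w.
Proof. by rewrite !cabs_normc; exact: le_normcD. Qed.

Lemma cabsN z : cabs (- z) = cabs z.
Proof. by rewrite !cabs_normc; exact: normcN. Qed.

Lemma cabs0 : cabs (0 : R[i]) = 0.
Proof. by rewrite cabs_normc ComplexField.Normc.normc0. Qed.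

Lemma cabs1 : cabs (1 : R[i]) = 1.
Proof. by rewrite cabs_normc ComplexField.Normc.normc1. Qed.

Lemma cabs_eq0 z : cabs z = 0 -> z = 0.
Proof. by rewrite cabs_normc; exact: ComplexField.Normc.eq0_normc. Qed.

Lemma cabs_gt0 z : (0 < cabs z) = (z != 0).
Proof.
rewrite lt0r cabs_ge0 andbT; congr negb; apply/eqP/eqP => [/cabs_eq0//|->].
exact: cabs0.
Qed.

Lemma cabsB z w : cabs (z - w) <= cabs z + cabs w.
Proof. by rewrite -[cabs w]cabsN cabsD. Qed.

Lemma cabs_sum_le (I : Type) (r : seq I) (P : pred I) (F : I -> R[i]) :
  cabs (\sum_(i <- r | P i) F i) <= \sum_(i <- r | P i) cabs (F i).
Proof.
elim/big_ind2 : _ => [|a b c d ab cd|//]; first by rewrite cabs0.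
exact: le_trans (cabsD _ _) (lerD ab cd).
Qed.

Lemma cabsX z n : cabs (z ^+ n) = cabs z ^+ n.
Proof. by elim: n => [|n IH]; rewrite ?expr0 ?cabs1// !exprS cabsM IH. Qed.

Lemma cabs_rc x : cabs (rc x) = `|x|.
Proof. by rewrite /cabs /= expr0n addr0 sqrtr_sqr. Qed.

Lemma cabs_ge0_rc x : 0 <= x -> cabs (rc x) = x.
Proof. by move=> x0; rewrite cabs_rc ger0_norm. Qed.

Lemma rcD x y : rc (x + y) = rc x + rc y.
Proof. by rewrite /rc; simpc. Qed.
Lemma rcN x : rc (- x) = - rc x.
Proof. by rewrite /rc; simpc. Qed.
Lemma rcB x y : rc (x - y) = rc x - rc y.
Proof. by rewrite rcD rcN. Qed.
Lemma rcM x y : rc (x * y) = rc x * rc y.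
Proof. by rewrite /rc; simpc. Qed.
Lemma rc0 : rc 0 = 0. Proof. by []. Qed.
Lemma rc1 : rc 1 = 1. Proof. by []. Qed.
Lemma rcX x n : rc (x ^+ n) = rc x ^+ n.
Proof. by elim: n => [|n IH]; rewrite ?expr0 ?rc1// !exprS rcM IH. Qed.
Lemma rc_nat n : rc n%:R = n%:R.
Proof. by elim: n => [|n IH]; rewrite ?rc0// !mulrS rcD IH. Qed.
Lemma rcV x : rc x^-1 = (rc x)^-1.
Proof.
have [->|x0] := eqVneq x 0; first by rewrite invr0 rc0 invr0.
have rx0 : rc x != 0.
  by apply/eqP => /(congr1 (@complex.Re R)) /=; move/eqP: x0.
by apply: (mulfI rx0); rewrite -rcM !divff.
Qed.

Lemma cReD z w : complex.Re (z + w) = complex.Re z + complex.Re w.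
Proof. by case: z; case: w. Qed.
Lemma cImD z w : complex.Im (z + w) = complex.Im z + complex.Im w.
Proof. by case: z; case: w. Qed.
Lemma cReN z : complex.Re (- z) = - complex.Re z.
Proof. by case: z. Qed.
Lemma cImN z : complex.Im (- z) = - complex.Im z.
Proof. by case: z. Qed.
Lemma cReM z w : complex.Re (z * w) =
  complex.Re z * complex.Re w - complex.Im z * complex.Im w.
Proof. by case: z => a b; case: w => c d; simpc. Qed.
Lemma cImM z w : complex.Im (z * w) =
  complex.Re z * complex.Im w + complex.Im z * complex.Re w.
Proof. by case: z => a b; case: w => c d; simpc. Qed.
Lemma Re_rcM x z : complex.Re (rc x * z) = x * complex.Re z.
Proof. by rewrite cReM /= mul0r subr0. Qed.
Lemma Im_rcM x z : complex.Im (rc x * z) = x * complex.Im z.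
Proof. by rewrite cImM /= mul0r addr0. Qed.

Lemma cRe_sum (I : Type) (r : seq I) (P : pred I) (F : I -> R[i]) :
  complex.Re (\sum_(i <- r | P i) F i) = \sum_(i <- r | P i) complex.Re (F i).
Proof. by elim/big_ind2 : _ => // a b c d <- <-; rewrite cReD. Qed.

Lemma sqr_cabs z : cabs z ^+ 2 = complex.Re z ^+ 2 + complex.Im z ^+ 2.
Proof. by rewrite sqr_sqrtr// addr_ge0 ?sqr_ge0. Qed.

Lemma norm_Re_le z : `|complex.Re z| <= cabs z.
Proof.
rewrite -(@ler_pXn2r _ 2)// ?nnegrE ?cabs_ge0// sqr_cabs real_normK ?num_real//.
by rewrite lerDl sqr_ge0.
Qed.

Lemma norm_Im_le z : `|complex.Im z| <= cabs z.
Proof.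
rewrite -(@ler_pXn2r _ 2)// ?nnegrE ?cabs_ge0// sqr_cabs real_normK ?num_real//.
by rewrite lerDr sqr_ge0.
Qed.

Lemma Re_le z : complex.Re z <= cabs z.
Proof. exact: le_trans (ler_norm _) (norm_Re_le z). Qed.

Lemma cabs_le_ReIm z : cabs z <= `|complex.Re z| + `|complex.Im z|.
Proof.
rewrite -(@ler_pXn2r _ 2)// ?nnegrE ?cabs_ge0 ?addr_ge0// sqr_cabs sqrrD.
rewrite !real_normK ?num_real// lerD2r lerDl mulrn_wge0// mulr_ge0//.
Qed.

Lemma cReV z : complex.Re z^-1 = complex.Re z / cabs z ^+ 2.
Proof. by rewrite sqr_cabs; case: z. Qed.

Lemma cabs_lerB z w : cabs z - cabs w <= cabs (z - w).
Proof. by rewrite lerBlDr -{1}(subrK w z) cabsD. Qed.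

Lemma cabs_expi k t : cabs (expi k t : R[i]) = 1.
Proof. by rewrite /cabs /= cos2Dsin2 sqrtr1. Qed.

Lemma expi_D t s : expi 1 (t + s) = expi 1 t * expi 1 s :> R[i].
Proof. by rewrite /expi mulrDr cosD sinD; simpc; congr Complex; ring. Qed.

Lemma expi_0 : expi 1 0 = 1 :> R[i].
Proof. by rewrite /expi mulr0 cos0 sin0. Qed.

Lemma expiX k t : expi k t = expi 1 t ^+ k :> R[i].
Proof.
elim: k => [|k IH]; first by rewrite expr0 /expi mulr0 mul0r cos0 sin0.
rewrite exprS -IH /expi -[k.+1%:R]natr1 mulrDr mulrDl cosD sinD; simpc.
by congr Complex; ring.
Qed.

Lemma expi_nat n : expi 1 n%:R = 1 :> R[i].
Proof.
elim: n => [|n IH]; first exact: expi_0.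
rewrite -natr1 expi_D IH mul1r /expi mulr1 mulr1.
have -> : 2 * pi = pi *+ 2 :> R by rewrite mulr_natl.
by rewrite cos2pi sin2pi.
Qed.

Lemma norm_sin_le x : `|sin x| <= `|x|.
Proof.
wlog x0 : x / 0 < x => [H|].
  have [x0|x0|->] := ltgtP x 0; last by rewrite sin0.
    by rewrite -normrN -(normrN x) -sinN; apply: H; rewrite oppr_gt0.
  exact: H.
have ctf : {within `[0, x], continuous (@sin R)}.
  by apply: continuous_subspaceT => y; exact: continuous_sin.
have [c _] := @MVT R sin cos 0 x x0 (fun c _ => is_derive_sin c) ctf.
rewrite sin0 !subr0 => ->; rewrite normrM ler_piMl//; exact: cos_max.
Qed.

Lemma cos_bound x : 0 <= 1 - cos x <= x ^+ 2 / 2.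
Proof.
have -> : cos x = 1 - 2 * sin (x / 2) ^+ 2.
  by rewrite [in LHS](splitr x) cosD -!expr2 cos2sin2; ring.
have /= := norm_sin_le (x / 2).
rewrite -(@ler_pXn2r _ 2)// ?nnegrE// !real_normK ?num_real//.
have := sqr_ge0 (sin (x / 2)).
move: (sin _ ^+ 2) => u; rewrite exprMn; lra.
Qed.

Lemma norm_sinB_le x : `|x| <= 1 -> `|sin x - x| <= x ^+ 2.
Proof.
wlog x0 : x / 0 < x => [H|].
  have [x0|x0|->] := ltgtP x 0; last by rewrite sin0 subrr normr0 expr0n.
    rewrite -(normrN x) -(sqrrN x) => h.
    rewrite -normrN opprD -sinN; apply: H => //; by rewrite oppr_gt0.
  exact: H.
have df (c : R) : is_derive c (1:R) (fun y : R => sin y - y) (cos c - 1).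
  by apply: is_deriveB.
have ctf : {within `[0, x], continuous (fun y : R => sin y - y)}.
  apply: continuous_subspaceT => y.
  by apply: continuousB; [exact: continuous_sin|exact: cvg_id].
have [c] := @MVT R _ (fun y => cos y - 1) 0 x x0 (fun c _ => df c) ctf.
rewrite in_itv/= sin0 !subr0 => /andP[c0 cx] ->.
rewrite (gtr0_norm x0) => x1; rewrite normrM (gtr0_norm x0) expr2.
rewrite ler_pM2r// distrC ger0_norm; have /andP[a b] := cos_bound c => //.
apply: (le_trans b); rewrite expr2; nra.
Qed.

(** The square of |e^(iv) - 1| is 2 (1 - cos v), which [cos_bound] estimates by v^2. *)
Lemma cabs_expiB_le t s : cabs (expi 1 t - expi 1 s : R[i]) <= 2 * pi * `|t - s|.
Proof.
have -> : expi 1 t - expi 1 s = (expi 1 (t - s) - 1) * expi 1 s :> R[i].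
  by rewrite mulrBl mul1r -expi_D subrK.
rewrite cabsM cabs_expi mulr1; move: (t - s) => u.
rewrite -(@ler_pXn2r _ 2)// ?nnegrE ?cabs_ge0 ?mulr_ge0 ?pi_ge0//.
rewrite exprMn real_normK ?num_real// sqr_cabs /= mulr1 oppr0 addr0 -exprMn.
set v := _ * u; have /andP[_ h] := cos_bound v.
have := cos2Dsin2 v; rewrite sqrrB; move: h; rewrite !expr2; lra.
Qed.

End ComplexModulus.

(** * The disc algebra on the circle *)

Section DiscAlgebra.
Set Implicit Arguments. Unset Strict Implicit. Unset Printing Implicit Defensive.
Variable R : realType.
Implicit Types (F G : R -> R[i]).

(* Boundary values of functions in the disc algebra, as 1-periodic functions. *)
Definition disc F := forall e : R, 0 < e ->
  exists P : {poly R[i]}, forall t, cabs (F t - P.[expi 1 t]) <= e.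

Lemma disc_lim F :
  (forall e : R, 0 < e -> exists G, disc G /\ forall t, cabs (F t - G t) <= e) ->
  disc F.
Proof.
move=> h e e0; have e20 : 0 < e / 2 by rewrite divr_gt0.
have [G [dG FG]] := h _ e20; have [P GP] := dG _ e20.
exists P => t; have -> : F t - P.[expi 1 t] = F t - G t + (G t - P.[expi 1 t]).
  by rewrite addrA subrK.
apply: (le_trans (cabsD _ _)); rewrite [leRHS]splitr; exact: lerD.
Qed.

Lemma disc_horner (P : {poly R[i]}) : disc (fun t => P.[expi 1 t]).
Proof. by move=> e e0; exists P => t; rewrite subrr cabs0 ltW. Qed.

Lemma eq_disc F G : (forall t, F t = G t) -> disc F -> disc G.
Proof. by move=> FG dF e /dF [P FP]; exists P => t; rewrite -FG. Qed.

Lemma disc_cst (c : R[i]) : disc (fun=> c).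
Proof. by apply: eq_disc (disc_horner c%:P) => t; rewrite hornerC. Qed.

Lemma discD F G : disc F -> disc G -> disc (fun t => F t + G t).
Proof.
move=> dF dG e e0; have e20 : 0 < e / 2 by rewrite divr_gt0.
have [P FP] := dF _ e20; have [Q GQ] := dG _ e20.
exists (P + Q) => t; rewrite hornerD opprD addrACA.
apply: (le_trans (cabsD _ _)); rewrite [leRHS]splitr; exact: lerD.
Qed.

Lemma disc_bounded F : disc F -> exists2 B : R, 0 < B & forall t, cabs (F t) <= B.
Proof.
move=> /(_ 1 ltr01) [P FP].
exists (1 + \sum_(i < size P) cabs P`_i).
  by rewrite ltr_wpDr// sumr_ge0// => i _; exact: cabs_ge0.
move=> t; rewrite -(subrK P.[expi 1 t] (F t)).
apply: (le_trans (cabsD _ _)); apply: lerD => //.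
rewrite horner_coef; apply: (le_trans (cabs_sum_le _ _ _)).
by apply: ler_sum => i _; rewrite cabsM cabsX cabs_expi expr1n mulr1.
Qed.

Lemma discM F G : disc F -> disc G -> disc (fun t => F t * G t).
Proof.
move=> dF dG e e0; have [B B0 GB] := disc_bounded dG.
have [P FP] := dF _ (divr_gt0 (divr_gt0 e0 (ltr0Sn R 1)) B0).
have [B' B'0 PB] := disc_bounded (disc_horner P).
have [Q GQ] := dG _ (divr_gt0 (divr_gt0 e0 (ltr0Sn R 1)) B'0).
exists (P * Q) => t; rewrite hornerM.
have -> : F t * G t - P.[expi 1 t] * Q.[expi 1 t] =
  (F t - P.[expi 1 t]) * G t + P.[expi 1 t] * (G t - Q.[expi 1 t]) by ring.
apply: (le_trans (cabsD _ _)); rewrite [leRHS]splitr !cabsM.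
apply: lerD.
  by rewrite -[leRHS](divfK (lt0r_neq0 B0)) ler_pM ?cabs_ge0.
by rewrite -[leRHS](divfK (lt0r_neq0 B'0)) mulrC ler_pM ?cabs_ge0.
Qed.

Lemma disc_sum (I : Type) (r : seq I) (P : pred I) (F : I -> R -> R[i]) :
  (forall i, P i -> disc (F i)) -> disc (fun t => \sum_(i <- r | P i) F i t).
Proof.
move=> dF; elim: r => [|i r IH].
  by apply: eq_disc (disc_cst 0) => t; rewrite big_nil.
apply: (@eq_disc (fun t => (if P i then F i t else 0) +
  \sum_(i <- r | P i) F i t)) => [t|].
  by rewrite big_cons; case: ifP => //; rewrite add0r.
by apply: discD IH; case: (boolP (P i)) => Pi; [exact: dF|exact: disc_cst].
Qed.

Lemma discX F n : disc F -> disc (fun t => F t ^+ n).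
Proof.
move=> dF; elim: n => [|n IH]; first exact: disc_cst.
by apply: eq_disc (discM dF IH) => t; rewrite exprS.
Qed.

Lemma discN F : disc F -> disc (fun t => - F t).
Proof.
by move=> dF; apply: eq_disc (discM (disc_cst (- 1)) dF) => t; rewrite mulN1r.
Qed.

Lemma discB F G : disc F -> disc G -> disc (fun t => F t - G t).
Proof. by move=> dF dG; exact: discD dF (discN dG). Qed.

Lemma disc_translate_expi s : disc (fun t => expi 1 (t - s)).
Proof.
apply: eq_disc (disc_horner (expi 1 (- s) *: 'X)) => t.
by rewrite hornerZ hornerX -expi_D addrC.
Qed.

Lemma geometric_small (r e : R) : 0 <= r -> r < 1 -> 0 < e ->
  exists n, r ^+ n <= e.
Proof.
move=> r0 r1 e0; have : `|r| < 1 by rewrite ger0_norm.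
move/cvg_expr/cvgr0Pnorm_le => /(_ e e0) [n _ /(_ n (leqnn n))] /=.
by rewrite ger0_norm ?exprn_ge0// => h; exists n.
Qed.

(* Neumann series: a large disc [D(Lam, Lam)] contains the range of [F]. *)
Lemma disc_inv F (d : R) : 0 < d -> (forall t, d <= complex.Re (F t)) ->
  disc F -> disc (fun t => (F t)^-1).
Proof.
move=> d0 Fd dF; have [B B0 FB] := disc_bounded dF.
(* |1 - F/Lam|^2 = 1 - (2 Re F - |F|^2/Lam)/Lam. The term B^2/d makes |F|^2/Lam at most d, so this
   is at most 1 - d/Lam; the extra d guarantees d/Lam <= 1, so that the square root [r] makes
   sense. *)
pose Lam := B ^+ 2 / d + d.
have L0 : 0 < Lam by rewrite addr_gt0// divr_gt0// exprn_gt0.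
pose Q t := 1 - rc Lam^-1 * F t.
have dQ : disc Q by apply: discB (disc_cst 1) (discM (disc_cst _) dF).
pose r := Num.sqrt (1 - d / Lam).
have dL : d / Lam <= 1 by rewrite ler_pdivrMr// mul1r lerDr divr_ge0 ?exprn_ge0 ?ltW.
have dL0 : 0 < d / Lam by rewrite divr_gt0.
have r1 : r < 1 by rewrite -sqrtr1 ltr_sqrt//; lra.
have Qr t : cabs (Q t) <= r.
  have r2 : r ^+ 2 = 1 - d / Lam by rewrite sqr_sqrtr// subr_ge0.
  rewrite -(@ler_pXn2r _ 2)// ?nnegrE ?cabs_ge0 ?sqrtr_ge0// r2.
  have : cabs (F t) ^+ 2 <= B ^+ 2 by rewrite ler_pXn2r// ?nnegrE ?cabs_ge0 ?(ltW B0).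
  have := Fd t; rewrite !sqr_cabs cReD cImD cReN cImN Re_rcM Im_rcM /=.
  move: (complex.Re _) (complex.Im _) => x y dx xy.
  have -> : (1 - Lam^-1 * x) ^+ 2 + (0 - Lam^-1 * y) ^+ 2 =
     1 - Lam^-1 * (2 * x) + Lam^-1 * (Lam^-1 * (x ^+ 2 + y ^+ 2)) by ring.
  have : Lam^-1 * (x ^+ 2 + y ^+ 2) <= d.
    rewrite mulrC ler_pdivrMr// (le_trans xy)// /Lam mulrDr mulrC divfK ?gt_eqF//=.
    by rewrite lerDl -expr2 sqr_ge0.
  have Li : 0 < Lam^-1 by rewrite invr_gt0.
  rewrite (mulrC d); move: (Lam^-1 * (x ^+ 2 + _)) => u ud.
  have h : 0 <= 2 * x - u - d by lra.
  by have := mulr_ge0 (ltW Li) h; rewrite !mulrBr; lra.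
apply: disc_lim => e e0.
have [n rn] : exists n, r ^+ n <= e * d.
  by apply: geometric_small => //; rewrite ?sqrtr_ge0 ?mulr_gt0.
exists (fun t => rc Lam^-1 * \sum_(0 <= k < n) Q t ^+ k); split.
  by apply: discM (disc_cst _) _; apply: disc_sum => i _; exact: discX.
move=> t; have F0 : F t != 0.
  by rewrite -cabs_gt0 (lt_le_trans d0)// (le_trans (Fd t))// Re_le.
have -> : (F t)^-1 - rc Lam^-1 * \sum_(0 <= k < n) Q t ^+ k = Q t ^+ n / F t.
  apply: (mulIf F0); rewrite mulrBl mulVf// divfK//.
  have -> : rc Lam^-1 * (\sum_(0 <= k < n) Q t ^+ k) * F t =
    - ((Q t - 1) * \sum_(0 <= k < n) Q t ^+ k) by rewrite /Q; ring.
  by rewrite big_mkord -subrX1 opprK addrC subrK.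
rewrite cabsM cabsV cabsX ler_pdivrMr ?cabs_gt0//.
apply: (@le_trans _ _ (r ^+ n)).
  by rewrite lerXn2r// nnegrE ?cabs_ge0 ?sqrtr_ge0.
apply: (le_trans rn); rewrite ler_pM2l//.
exact: le_trans (Fd t) (Re_le _).
Qed.

Definition cexp (z : R[i]) : R[i] :=
  rc (expR (complex.Re z)) * Complex (cos (complex.Im z)) (sin (complex.Im z)).

Lemma cexpD z w : cexp (z + w) = cexp z * cexp w.
Proof.
rewrite /cexp cReD cImD expRD cosD sinD rcM mulrACA; congr (_ * _).
by simpc; congr Complex; ring.
Qed.

Lemma cexp0 : cexp 0 = 1.
Proof. by rewrite /cexp /= expR0 cos0 sin0 mul1r. Qed.

Lemma cexpMn z n : cexp (z *+ n) = cexp z ^+ n.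
Proof. by elim: n => [|n IH]; rewrite ?cexp0// mulrS cexpD IH exprS. Qed.

Lemma cabs_cexp z : cabs (cexp z) = expR (complex.Re z).
Proof.
by rewrite cabsM cabs_ge0_rc ?expR_ge0// /cabs /= cos2Dsin2 sqrtr1 mulr1.
Qed.

Lemma Re_cexp z : complex.Re (cexp z) = expR (complex.Re z) * cos (complex.Im z).
Proof. by rewrite Re_rcM. Qed.

Lemma expRB_bound (x : R) : `|x| <= 1 / 2 -> `|expR x - 1 - x| <= 2 * x ^+ 2.
Proof.
move=> xh; have [h1 h2] : - (1 / 2) <= x /\ x <= 1 / 2.
  by move: xh; rewrite ler_norml => /andP.
have lo := expR_ge1Dx x; have := expR_ge1Dx (- x).
rewrite ger0_norm; last lra.
move=> h; suff : expR x * (1 - x) <= 1 by nra.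
have E0 : expR x != 0 by rewrite gt_eqF ?expR_gt0.
by rewrite -[leRHS](mulfV E0) -expRN ler_pM2l ?expR_gt0.
Qed.

Lemma cexp_bound z : cabs z <= 1 / 2 -> cabs (cexp z - 1 - z) <= 8 * cabs z ^+ 2.
Proof.
move=> zh; have xh := le_trans (norm_Re_le z) zh; have yh := le_trans (norm_Im_le z) zh.
apply: (le_trans (cabs_le_ReIm _)).
rewrite !cReD !cImD !cReN !cImN Re_cexp Im_rcM sqr_cabs.
move: (complex.Re z) (complex.Im z) xh yh => x y xh yh /=; rewrite subr0.
have ex := expRB_bound xh.
have /andP[c0 c2] := cos_bound y.
have y1 : `|y| <= 1 by lra.
have sy := norm_sinB_le y1.
have [h1 h2] : - (1 / 2) <= x /\ x <= 1 / 2.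
  by move: xh; rewrite ler_norml => /andP.
have ex4 : expR x <= 2.
  by move: ex; rewrite ler_norml => /andP[_]; rewrite expr2; nra.
have := expR_gt0 x.
move: (expR x) (cos y) (sin y) ex c0 c2 sy ex4 => E c s ex c0 c2 sy E2 E0.
have a1 : `|E * c - 1 - x| <= 2 * x ^+ 2 + y ^+ 2.
  have -> : E * c - 1 - x = (E - 1 - x) - E * (1 - c) by ring.
  apply: (le_trans (ler_normB _ _)); apply: lerD => //.
  rewrite ger0_norm; nra.
have a2 : `|E * s - y| <= 2 * y ^+ 2 + (x ^+ 2 + y ^+ 2) + x ^+ 2.
  have -> : E * s - y = E * (s - y) + (x * y + (E - 1 - x) * y) by ring.
  have b1 : `|E * (s - y)| <= 2 * y ^+ 2 by rewrite normrM (gtr0_norm E0) ler_pM// ltW.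
  have b2 : `|x * y| <= x ^+ 2 + y ^+ 2.
    by rewrite ler_norml !expr2; apply/andP; split; nra.
  have b3 : `|(E - 1 - x) * y| <= x ^+ 2.
    rewrite normrM; apply: (@le_trans _ _ (2 * x ^+ 2 * (1 / 2))); last lra.
    by apply: ler_pM.
  have := ler_normD (E * (s - y)) (x * y + (E - 1 - x) * y).
  have := ler_normD (x * y) ((E - 1 - x) * y).
  lra.
have := sqr_ge0 x; have := sqr_ge0 y; lra.
Qed.

Lemma expr_diff_le (a b : R[i]) (B : R) n : cabs a <= B -> cabs b <= B ->
  cabs (a ^+ n.+1 - b ^+ n.+1) <= n.+1%:R * B ^+ n * cabs (a - b).
Proof.
move=> aB bB; have B0 : 0 <= B := le_trans (cabs_ge0 a) aB.
rewrite subrXX cabsM mulrC ler_wpM2r ?cabs_ge0//.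
apply: (le_trans (cabs_sum_le _ _ _)).
apply: (@le_trans _ _ (\sum_(i < n.+1) B ^+ n)); last by rewrite sumr_const card_ord mulr_natl.
apply: ler_sum => i _; rewrite cabsM !cabsX.
have -> : B ^+ n = B ^+ (n - i) * B ^+ i by rewrite -exprD subnK// -ltnS.
apply: ler_pM; rewrite ?exprn_ge0 ?cabs_ge0//;
  by rewrite lerXn2r// nnegrE cabs_ge0.
Qed.

(** Euler's limit (1 + F/N)^N is uniform for bounded F: compare it with exp(F/N)^N by
    [expr_diff_le], the bases differing by O(N^-2). *)
Lemma disc_cexp F : disc F -> disc (fun t => cexp (F t)).
Proof.
move=> dF; have [B B0 FB] := disc_bounded dF.
apply: disc_lim => e e0.
(* The summand 2B gives |F/N| <= 1/2, as [cexp_bound] requires; the other one makes the final error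
   8 B^2 e^B / N at most e. *)
pose N := (Num.truncn (2 * B + 8 * B ^+ 2 * expR B / e)).+1.
have N0 : 0 < N%:R :> R by rewrite ltr0n.
have NB : 2 * B + 8 * B ^+ 2 * expR B / e < N%:R.
  by apply: truncnS_gt.
exists (fun t => (1 + rc N%:R^-1 * F t) ^+ N); split.
  by apply: discX; apply: discD (disc_cst 1) (discM (disc_cst _) dF).
move=> t; set z := rc N%:R^-1 * F t.
have zE : cabs z = N%:R^-1 * cabs (F t) by rewrite cabsM cabs_ge0_rc ?invr_ge0 ?ltW.
have zB : cabs z <= B / N%:R by rewrite zE mulrC ler_pM2r ?invr_gt0.
have -> : cexp (F t) = cexp z ^+ N.
  have zN : z *+ N = F t.
    by rewrite -mulr_natl /z rcV rc_nat mulrA divff ?mul1r// pnatr_eq0.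
  by rewrite -cexpMn zN.
have p0 : 0 <= 8 * B ^+ 2 * expR B / e.
  by rewrite divr_ge0 ?mulr_ge0 ?expR_ge0 ?sqr_ge0 ?ltW.
have zh : cabs z <= 1 / 2.
  apply: (le_trans zB); rewrite ler_pdivrMr//; lra.
have bE : expR (B / N%:R) ^+ N = expR B.
  by rewrite -expRM_natl mulrC divfK// gt_eqF.
have E1 : 1 <= expR (B / N%:R).
  by apply: le_trans (expR_ge1Dx _); rewrite lerDl divr_ge0// ltW.
apply: (le_trans (@expr_diff_le _ _ (expR (B / N%:R)) _ _ _)).
- by rewrite cabs_cexp ler_expR (le_trans (Re_le _)).
- apply: (le_trans (cabsD _ _)); rewrite cabs1.
  by apply: (@le_trans _ _ (1 + B / N%:R)); rewrite ?expR_ge1Dx// lerD2l.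
rewrite opprD addrA.
apply: (@le_trans _ _ (N%:R * expR B * (8 * (B / N%:R) ^+ 2))).
  have e0' := expR_ge0 (B / N%:R); apply: ler_pM; rewrite ?cabs_ge0// ?mulr_ge0 ?exprn_ge0//.
  - by rewrite ler_pM2l// -[leRHS]bE ler_weXn2l// leqnSn.
  - apply: (le_trans (cexp_bound zh)); rewrite ler_pM2l//.
    by rewrite lerXn2r// nnegrE ?cabs_ge0 ?divr_ge0 ?ltW.
have -> : N%:R * expR B * (8 * (B / N%:R) ^+ 2) = 8 * B ^+ 2 * expR B / N%:R.
  by field; rewrite gt_eqF.
by rewrite ler_pdivrMr// (mulrC e) -ler_pdivrMr//; lra.
Qed.

End DiscAlgebra.

(** * Logarithmically regular weights and analytic cutoffs *)

Section LogRegular.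
Set Implicit Arguments. Unset Strict Implicit. Unset Printing Implicit Defensive.
Variable R : realType.
Implicit Types (F G : R -> R[i]) (w : R -> R).

Lemma cabs_real_addl (x : R) (z : R[i]) : 0 <= x -> 0 <= complex.Re z ->
  x <= cabs (rc x + z) /\ cabs z <= cabs (rc x + z).
Proof.
move=> x0 z0; split.
  by apply: le_trans (Re_le _); rewrite cReD /= lerDl.
rewrite -(@ler_pXn2r _ 2)// ?nnegrE ?cabs_ge0// !sqr_cabs cReD cImD /= add0r lerD2r.
by rewrite lerXn2r// ?nnegrE ?addr_ge0// lerDr.
Qed.

Lemma sum_pow2 (m : nat) : \sum_(j < m) (2 : R) ^+ j <= 2 ^+ m.
Proof.
elim: m => [|m IH]; first by rewrite big_ord0 expr0 ler01.
by rewrite big_ord_recr /= exprS mulr2n mulrDl !mul1r lerD2r.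
Qed.

Lemma sum_pow2V (n : nat) : \sum_(j < n) (2 : R) ^- j <= 2.
Proof.
suff : \sum_(j < n) (2 : R) ^- j <= 2 - 2 * 2 ^- n.
  move=> /le_trans; apply; rewrite gerBl mulr_ge0// invr_ge0 exprn_ge0//.
elim: n => [|n IH]; first by rewrite big_ord0 expr0 invr1 mulr1 subrr.
rewrite big_ord_recr /= exprS invfM; move: IH; move: (2 ^- n) => u; lra.
Qed.

(* Each term [z / (l_j + z)] is close to 1 or to 0 according to whether
   [l_j = 2 ^ (j - J)] is below or above [cabs z]: the sum counts dyadic
   levels, with a complex error summing two geometric series. *)
Lemma dyadic_log (J : nat) (z : R[i]) : 0 <= complex.Re z ->
  2 ^- J <= cabs z -> cabs z < 2 ^+ J ->
  cabs (rc (ln 2) * (\sum_(j < J + J) z / (rc (2 ^+ j / 2 ^+ J) + z) - J%:R)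
        - rc (ln (cabs z))) <= 5.
Proof.
move=> z0 zlo zhi; set a := cabs z.
have p0 n : 0 < (2 : R) ^+ n by exact: exprn_gt0.
have a0 : 0 < a by apply: lt_le_trans zlo; rewrite invr_gt0.
pose l (j : nat) : R := 2 ^+ j / 2 ^+ J.
have l0 j : 0 < l j by rewrite divr_gt0.
have exm : exists m, a < l m.
  by exists (J + J)%N; rewrite /l exprD mulfK ?gt_eqF.
(* First dyadic level above |z|. Since l_(m-1) <= |z| < l_m, ln |z| is within ln 2 <= 1 of ln 2 (m -
   J); this gives the final 1 in 5 = 4 + 1. *)
pose m := ex_minn exm.
have [am mmin] : a < l m /\ forall j, a < l j -> (m <= j)%N.
  by rewrite /m; case: ex_minnP => k h1 h2; split.
have m2J : (m <= J + J)%N by apply: mmin; rewrite /l exprD mulfK ?gt_eqF.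
have lj j : (j < m)%N -> l j <= a.
  by move=> jm; rewrite leNgt; apply/negP => /mmin; rewrite leqNgt jm.
have m0 : (0 < m)%N.
  by rewrite lt0n; apply/eqP => m0; move: am; rewrite m0 /l expr0 mul1r ltNge zlo.
have lS j : l j.+1 = 2 * l j by rewrite /l exprS mulrA.
have lm2 : l m <= 2 * a.
  by rewrite -(prednK m0) lS ler_pM2l// lj// prednK.
have zl j : z + rc (l j) != 0.
  rewrite -cabs_gt0 addrC (lt_le_trans a0)//.
  by have [] := cabs_real_addl (ltW (l0 j)) z0.
(* Terms below level m differ from 1 by at most l_j / |z|, the others are at most |z| / l_j; each
   geometric series contributes at most 2. *)
have main : cabs (\sum_(j < J + J) z / (rc (l j) + z) - m%:R) <= 4.
  rewrite -(big_mkord xpredT (fun j => z / (rc (l j) + z))).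
  rewrite (big_cat_nat (n := m))//=.
  have -> : m%:R = \sum_(0 <= j < m) (1 : R[i]) by rewrite sumr_const_nat subn0.
  rewrite addrAC -sumrB; apply: (le_trans (cabsD _ _)).
  have -> : 4 = 2 + 2 :> R by ring.
  apply: lerD; apply: (le_trans (cabs_sum_le _ _ _)).
    apply: (@le_trans _ _ (\sum_(j < m) a^-1 * (2 ^- J * 2 ^+ j))).
      rewrite big_mkord; apply: ler_sum => j _.
      have -> : z / (rc (l j) + z) - 1 = - (rc (l j) / (rc (l j) + z)).
        by field; rewrite addrC zl.
      rewrite cabsN cabsM cabsV (cabs_ge0_rc (ltW (l0 j))).
      have -> : a^-1 * (2 ^- J * 2 ^+ j) = l j * a^-1.
        by rewrite /l mulrC [2 ^- J * _]mulrC.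
      have [_ h] := cabs_real_addl (ltW (l0 j)) z0.
      by rewrite ler_pM2l// lef_pV2// posrE// (lt_le_trans a0).
    rewrite -!mulr_sumr mulrC ler_pdivrMr//; apply: le_trans lm2.
    by rewrite mulrC /l ler_pM2r ?invr_gt0 ?sum_pow2.
  apply: (@le_trans _ _ (\sum_(j < J + J - m) 2 ^- j)); last exact: sum_pow2V.
  rewrite -{1}[m]add0n big_addn big_mkord; apply: ler_sum => j _.
  rewrite cabsM cabsV.
  have [h _] := cabs_real_addl (ltW (l0 (j + m)%N)) z0.
  have h0 : 0 < cabs (rc (l (j + m)%N) + z) by exact: lt_le_trans h.
  rewrite ler_pdivrMr// mulrC; apply: (@le_trans _ _ (l m)); first exact: ltW.
  rewrite ler_pdivlMr//; apply: le_trans h.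
  by have -> : l m * 2 ^+ j = l (j + m)%N by rewrite /l exprD; ring.
have ln2 : 0 <= ln (2 : R) <= 1.
  apply/andP; split; first by apply: ln_ge0; rewrite ler1n.
  by apply: (@le_ln1Dx R 1); apply: lt_trans ltr01; rewrite oppr_lt0.
have lnl j : ln (l j) = ln 2 * (j%:R - J%:R).
  by rewrite /l ln_div ?posrE// !lnXn// mulrBr !mulr_natr.
have lna : `|ln 2 * (m%:R - J%:R) - ln a| <= 1.
  rewrite ler_norml; apply/andP; split.
    rewrite -lnl (@le_trans _ _ 0) ?lerN10//.
    by rewrite subr_ge0 ler_ln ?posrE// ltW.
  have : ln (l m.-1) <= ln a by rewrite ler_ln ?posrE// lj// prednK.
  have mE : m%:R = m.-1%:R + 1 :> R by rewrite natr1 prednK.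
  have /andP[_ ?] := ln2.
  by rewrite lnl mE !mulrBr mulrDr; lra.
set S := \sum_(j < _) _ in main *.
have -> : rc (ln 2) * (S - J%:R) - rc (ln a) =
    rc (ln 2) * (S - m%:R) + rc (ln 2 * (m%:R - J%:R) - ln a).
  by rewrite rcB rcM rcB !rc_nat; ring.
apply: (le_trans (cabsD _ _)); rewrite cabsM cabs_rc (ger0_norm (_ : 0 <= ln 2)); last by case/andP: ln2.
rewrite cabs_rc; have -> : 5 = 1 * 4 + 1 :> R by ring.
by apply: lerD => //; apply: ler_pM; rewrite ?cabs_ge0//; case/andP: ln2.
Qed.

(* A quantitative form of [log w \in BMO]: [ln w] is within [K] of [Re L], where
   [L] is analytic and [Im L] is bounded by [K]. *)
Definition logreg (K : R) w :=
  exists2 L, disc L & forall t, cabs (L t - rc (ln (w t))) <= K.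

(** A function with values in the right half-plane has argument at most pi/2, so log |F| has a
    bounded conjugate. The rational sum of [dyadic_log] stands in for the analytic logarithm: its
    terms are in the disc algebra by [disc_inv]. Only the number of levels depends on d and on the
    bound of F; the constant 5 does not. *)
Lemma logreg_cabs F (d : R) : 0 < d -> (forall t, d <= complex.Re (F t)) ->
  disc F -> logreg 5 (fun t => cabs (F t)).
Proof.
move=> d0 Fd dF; have [B B0 FB] := disc_bounded dF.
have h2 : (1/2 : R) < 1 by lra.
have [J1 J1d] := @geometric_small R (1 / 2) (Num.min d (B + 1)^-1) ltac:(lra) h2
  ltac:(by rewrite lt_min d0 invr_gt0 ltr_wpDl// ltW).
have p0 n : 0 < (2 : R) ^+ n by exact: exprn_gt0.
move: J1d; rewrite div1r exprVn le_min => /andP[Jd JB].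
exists (fun t => rc (ln 2) *
   (\sum_(j < J1 + J1) F t / (rc (2 ^+ j / 2 ^+ J1) + F t) - J1%:R)).
  apply: discM (disc_cst _) (discB _ (disc_cst _)); apply: disc_sum => j _.
  apply: discM => //; apply: (@disc_inv _ _ d) => //.
    move=> t; rewrite cReD /= (le_trans (Fd t))// lerDr divr_ge0// ltW//.
  exact: discD (disc_cst _) dF.
move=> t; apply: dyadic_log; first exact: le_trans (ltW d0) (Fd t).
  by apply: (le_trans Jd); apply: (le_trans (Fd t)); exact: Re_le.
apply: (le_lt_trans (FB t)); apply: (@lt_le_trans _ _ (B + 1)).
  by rewrite ltrDl.
by rewrite -lef_pV2 ?posrE// addr_gt0.
Qed.

Lemma logreg_cst (c : R) : logreg 0 (fun=> c).
Proof.
by exists (fun=> rc (ln c)); [exact: disc_cst|move=> t; rewrite subrr cabs0].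
Qed.

Lemma logregM K1 K2 w1 w2 : (forall t, 0 < w1 t) -> (forall t, 0 < w2 t) ->
  logreg K1 w1 -> logreg K2 w2 -> logreg (K1 + K2) (fun t => w1 t * w2 t).
Proof.
move=> w10 w20 [L1 d1 h1] [L2 d2 h2]; exists (fun t => L1 t + L2 t).
  exact: discD.
move=> t; rewrite lnM ?posrE// rcD opprD addrACA.
exact: le_trans (cabsD _ _) (lerD (h1 t) (h2 t)).
Qed.

Lemma logreg_powR K w s : logreg K w -> logreg (`|s| * K) (fun t => w t `^ s).
Proof.
move=> [L d h]; exists (fun t => rc s * L t); first exact: discM (disc_cst _) d.
move=> t; rewrite ln_powR rcM -mulrBr cabsM cabs_rc.
by rewrite ler_wpM2l.
Qed.

Lemma logregV K w : (forall t, 0 < w t) -> logreg K w -> logreg K (fun t => (w t)^-1).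
Proof.
move=> w0 /(logreg_powR (- 1)); rewrite normrN normr1 mul1r => -[L d h].
by exists L => // t; rewrite -powR_inv1 ?(ltW (w0 t)).
Qed.

(* With [V ~ w ^ (1/m)] in the right half-plane, [(1 + V)^-m] is small where
   [w] is large, and [1 - (1 - (1 + V)^-m) ^ m] moreover is close to 1, at the
   rate [w], where [w] is small. *)
Lemma analytic_cutoff (K : R) : exists2 C : R, 0 < C & forall w,
  (forall t, 0 < w t) -> logreg K w ->
  exists2 Phi, disc Phi & forall t,
    [/\ cabs (Phi t) <= C, cabs (Phi t) * w t <= C,
        cabs (1 - Phi t) <= C & cabs (1 - Phi t) <= C * w t].
Proof.
(* As ln w is real, |Im L| <= K <= m. Hence Im (L/m) is at most 1 < pi/2, and V = exp (L/m) lies in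
   the right half-plane while |V|^m is w up to the factor E. *)
pose n := Num.truncn K; pose m := n.+1.
have Km : K <= m%:R by apply/ltW/truncnS_gt.
have m0 : 0 < m%:R :> R by rewrite ltr0n.
have m1 : 1 <= m%:R :> R by rewrite ler1n.
pose E := Num.max 1 (expR K); have E0 : 0 < E by rewrite lt_max ltr01.
have E1 : 1 <= E by rewrite le_max lexx.
have EK : expR K <= E by rewrite le_max lexx orbT.
pose C1 : R := m%:R * 2 ^+ n.
have C10 : 0 < C1 by rewrite mulr_gt0// exprn_gt0.
pose C2 : R := m%:R ^+ m.
have C20 : 0 < C2 by rewrite exprn_gt0.
exists ((C1 + C2) * E); first by rewrite mulr_gt0// addr_gt0.
move=> w w0 [L dL hL].
pose V t := cexp (rc m%:R^-1 * L t).
have dV : disc V by apply: disc_cexp; exact: discM (disc_cst _) dL.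
have ReV0 t : 0 <= complex.Re (V t).
  rewrite Re_cexp mulr_ge0 ?expR_ge0// Im_rcM; apply: cos_ge0_pihalf.
  suff : `|m%:R^-1 * complex.Im (L t)| <= 1.
    have := @pihalf_ge1 R; rewrite ler_norml => h /andP[h1 h2].
    by apply/andP; split; lra.
  rewrite normrM (gtr0_norm (_ : 0 < m%:R^-1)) ?invr_gt0// mulrC ler_pdivrMr// mul1r.
  apply: le_trans Km; apply: le_trans (hL t); apply: le_trans (norm_Im_le _).
  by rewrite cImD cImN /= subr0.
have Vm t : cabs (V t) ^+ m = expR (complex.Re (L t)).
  by rewrite cabs_cexp -expRM_natl Re_rcM mulrA divff ?gt_eqF// mul1r.
have RL t : `|complex.Re (L t) - ln (w t)| <= K.
  by apply: le_trans (hL t); apply: le_trans (norm_Re_le _); rewrite cReD cReN.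
have wE t : w t = expR (ln (w t)) by rewrite lnK// posrE.
have Vlo t : w t <= E * cabs (V t) ^+ m.
  rewrite Vm {1}wE; apply: (@le_trans _ _ (expR K * expR (complex.Re (L t)))).
    rewrite -expRD ler_expR; have := RL t; rewrite ler_norml => /andP[]; lra.
  by rewrite ler_pM2r ?expR_gt0.
have Vhi t : cabs (V t) ^+ m <= E * w t.
  rewrite Vm [in leRHS]wE; apply: (@le_trans _ _ (expR K * expR (ln (w t)))).
    rewrite -expRD ler_expR; have := RL t; rewrite ler_norml => /andP[]; lra.
  by rewrite ler_pM2r ?expR_gt0.
pose G t := (1 + V t)^-1.
have dG : disc G.
  apply: (@disc_inv _ _ 1) => //; last exact: discD (disc_cst _) dV.
  by move=> t; rewrite cReD /= lerDl ReV0.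
have oneV t : 1 <= cabs (1 + V t) /\ cabs (V t) <= cabs (1 + V t).
  by have := cabs_real_addl ler01 (ReV0 t).
have V0 t : 0 < cabs (1 + V t) by apply: lt_le_trans (oneV t).1.
have G1 t : cabs (G t) <= 1.
  by rewrite cabsV invf_le1//; case: (oneV t).
have GV t : cabs (G t) * cabs (V t) <= 1.
  by rewrite cabsV mulrC ler_pdivrMr// mul1r; case: (oneV t).
have one_G t : 1 - G t = V t * G t.
  have V0' : 1 + V t != 0 by rewrite -cabs_gt0.
  by rewrite /G; field.
have Gm t : cabs (1 - G t ^+ m) <= m%:R * cabs (V t * G t).
  rewrite -one_G -[X in X - _ ^+ _](expr1n _ m).
  apply: (le_trans (@expr_diff_le _ _ _ 1 _ _ _)); rewrite ?cabs1//.
  by rewrite expr1n mulr1.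
have Gm1 t : cabs (G t ^+ m) <= 1 by rewrite cabsX exprn_ile1 ?cabs_ge0.
(* 1 - G^m contains the factor 1 - G = V G, so its m-th power is O(|V|^m) = O(w); and Phi contains
   the factor G^m = O(1/w). [C1] and [C2] are the constants of these two factorizations. *)
pose Phi t := 1 - (1 - G t ^+ m) ^+ m.
have PhiG t : cabs (Phi t) <= C1 * cabs (G t) ^+ m.
  rewrite /Phi -[X in X - _](expr1n _ m).
  apply: (le_trans (@expr_diff_le _ _ _ 2 _ _ _)); rewrite ?cabs1 ?ler1n//.
    by apply: (le_trans (cabsB _ _)); rewrite cabs1 -[leRHS]/(1 + 1) lerD2l.
  by rewrite opprB addrC subrK cabsX.
have PsiG t : cabs (1 - Phi t) <= C2 * cabs (V t * G t) ^+ m.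
  rewrite /Phi opprB addrC subrK cabsX -exprMn.
  by rewrite lerXn2r ?nnegrE ?cabs_ge0// mulr_ge0 ?cabs_ge0// ltW.
have C12 : C1 <= (C1 + C2) * E.
  by rewrite -[leLHS]mulr1 ler_pM ?lerDl// ltW.
have C22 : C2 <= (C1 + C2) * E.
  by rewrite -[leLHS]mulr1 ler_pM ?lerDr// ltW.
exists Phi.
  by apply: discB (disc_cst _) (discX _ _); apply: discB (disc_cst _) (discX _ _).
move=> t; split.
- apply: (le_trans (PhiG t)); apply: le_trans C12.
  by rewrite -[leRHS]mulr1 ler_pM2l// exprn_ile1 ?cabs_ge0.
- apply: (@le_trans _ _ (C1 * cabs (G t) ^+ m * (E * cabs (V t) ^+ m))).
    by apply: ler_pM; rewrite ?cabs_ge0// ltW.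
  rewrite mulrACA -exprMn mulrAC; apply: (@le_trans _ _ (C1 * E * 1)).
    rewrite -mulrA [_ * E]mulrC mulrA ler_pM2l ?mulr_gt0//.
    by rewrite exprn_ile1// mulr_ge0 ?cabs_ge0.
  by rewrite mulr1 ler_pM2r// lerDl ltW.
- apply: (le_trans (PsiG t)); apply: le_trans C22.
  rewrite -[leRHS]mulr1 ler_pM2l// exprn_ile1 ?cabs_ge0// cabsM mulrC.
  exact: GV.
- apply: (le_trans (PsiG t)).
  apply: (@le_trans _ _ (C2 * (E * w t))).
    rewrite ler_pM2l//; apply: le_trans (Vhi t).
    rewrite lerXn2r ?nnegrE ?cabs_ge0// cabsM -[leRHS]mulr1.
    by rewrite ler_wpM2l ?cabs_ge0.
  by rewrite mulrA ler_pM2r// ler_pM2r// lerDr ltW.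
Qed.

End LogRegular.

(** * The discrete Cauchy projection *)

Section DiscreteCauchy.
Set Implicit Arguments. Unset Strict Implicit. Unset Printing Implicit Defensive.
Variable R : realType.
Implicit Types (v w : nat -> R) (z : R[i]) (t s : R).

Lemma conjc_mul_cabs z : z * conjc z = rc (cabs z ^+ 2).
Proof. by rewrite sqr_cabs; case: z => a b /=; simpc; congr Complex; ring. Qed.

Lemma cabs_conjc z : cabs (conjc z) = cabs z.
Proof. by case: z => a b; rewrite /cabs /= sqrrN. Qed.

Lemma rcI : injective (@rc R). Proof. by move=> x y []. Qed.

Lemma root_of_unity_sum (z : R[i]) M : z != 1 -> z ^+ M = 1 ->
  \sum_(j < M) z ^+ j = 0.
Proof.
move=> z1 zM; apply/eqP; have := subrX1 z M; rewrite zM subrr => /esym/eqP.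
by rewrite mulf_eq0 subr_eq0 (negbTE z1).
Qed.

Lemma rc_sum (I : Type) (r : seq I) (P : pred I) (F : I -> R) :
  rc (\sum_(i <- r | P i) F i) = \sum_(i <- r | P i) rc (F i).
Proof. by elim/big_ind2 : _ => // a b c d <- <-; rewrite rcD. Qed.

(** The hypotheses make [om] a primitive M-th root of unity. Expanding the squares, the off-diagonal
    terms vanish by [root_of_unity_sum]. The root is kept abstract because [cauchy_l2] uses both a
    root and its conjugate. *)
Lemma parseval_finite (M : nat) (om : R[i]) (g : nat -> R[i]) :
  cabs om = 1 -> om ^+ M = 1 ->
  (forall d, (0 < d < M)%N -> om ^+ d != 1) ->
  \sum_(j < M) cabs (\sum_(k < M) g k * om ^+ (j * k)) ^+ 2 =
  M%:R * \sum_(k < M) cabs (g k) ^+ 2.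
Proof.
move=> om1 omM omd; apply: rcI.
rewrite rc_sum rcM rc_nat rc_sum.
have omc : om * conjc om = 1 by rewrite conjc_mul_cabs om1 expr1n.
have omcM : conjc om ^+ M = 1.
  by have := rmorphXn (@conjc R) M om; rewrite omM rmorph1.
have -> : \sum_(j < M) rc (cabs (\sum_(k < M) g k * om ^+ (j * k)) ^+ 2) =
  \sum_(j < M) \sum_(k < M) \sum_(l < M)
     g k * conjc (g l) * (om ^+ k * conjc om ^+ l) ^+ j.
  apply: eq_bigr => j _; rewrite -conjc_mul_cabs rmorph_sum big_distrlr /=.
  apply: eq_bigr => k _; apply: eq_bigr => l _.
  by rewrite rmorphM rmorphXn /= exprMn -!exprM mulrACA ![(_ * j)%N]mulnC.
rewrite exchange_big /= mulr_sumr; apply: eq_bigr => k _.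
rewrite exchange_big /= (bigD1 k) //= -mulr_sumr.
rewrite -exprMn omc expr1n.
have -> : \sum_(i < M) (1 : R[i]) ^+ i = M%:R.
  by under eq_bigr do rewrite expr1n; rewrite sumr_const card_ord.
rewrite conjc_mul_cabs big1 ?addr0; first by rewrite mulrC.
move=> l lk; rewrite -mulr_sumr.
rewrite root_of_unity_sum ?mulr0//; last first.
  by rewrite exprMn -!exprM ![(_ * M)%N]mulnC !exprM omM omcM !expr1n mulr1.
have cj (a b : nat) : om ^+ a * conjc om ^+ b = 1 -> om ^+ a = om ^+ b.
  move=> h; have: om ^+ a * (om * conjc om) ^+ b = om ^+ b.
    by rewrite exprMn mulrCA h mulr1.
  by rewrite omc expr1n mulr1.
have om0 : om != 0 by rewrite -cabs_gt0 om1.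
apply/eqP => /cj.
have [kl|kl|/ord_inj kl] := ltngtP k l; last by rewrite kl eqxx in lk.
  rewrite -(subnK (ltnW kl)) exprD -{1}[om ^+ k]mul1r.
  move/(mulIf (expf_neq0 k om0))/esym/eqP; apply/negP/omd.
  by rewrite subn_gt0 kl (leq_ltn_trans (leq_subr _ _)).
rewrite -{1}(subnK (ltnW kl)) exprD -[RHS]mul1r.
move/(mulIf (expf_neq0 l om0))/eqP; apply/negP/omd.
by rewrite subn_gt0 kl (leq_ltn_trans (leq_subr _ _)).
Qed.

Lemma expi_natM (n : nat) t : expi 1 (n%:R * t) = expi 1 t ^+ n :> R[i].
Proof.
elim: n => [|n IH]; first by rewrite mul0r expi_0.
by rewrite -natr1 mulrDl mul1r expi_D IH exprSr.
Qed.

Lemma expi_neq1 t : 0 < t < 1 -> expi 1 t != 1 :> R[i].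
Proof.
move=> /andP[t0 t1]; apply/eqP => /(congr1 (@complex.Re R)) /=.
have -> : 2 * pi * 1 * t = pi * t + pi * t by ring.
rewrite cosD -!expr2 cos2sin2 => h.
have : 0 < sin (pi * t).
  by apply: sin_gt0_pi; rewrite mulr_gt0 ?pi_gt0//= -[ltRHS]mulr1 ltr_pM2l ?pi_gt0.
by move/(exprn_gt0 2); lra.
Qed.

Lemma expiN t : expi 1 (- t) = conjc (expi 1 t) :> R[i].
Proof. by rewrite /expi mulrN cosN sinN. Qed.

(* [ckernel M] is [1 / (1 - r e^(2 pi i t))] with [r = 1 - 1/M], scaled so that
   its real part is at least 1 at distance at most [1/M] from 0. *)
Definition cpi : R := 1 + (2 * pi) ^+ 2.
Definition cradius (M : nat) : R := 1 - M%:R^-1.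
Definition cden (M : nat) t : R[i] := 1 - rc (cradius M) * expi 1 t.
Definition ckernel (M : nat) t : R[i] := rc (cpi / M%:R) * (cden M t)^-1.
(** This is the operator T: [cpi] times the Cauchy integral, at radius 1 - 1/M, of the measure with
    mass [v i] / M at each grid point. *)
Definition cauchy_sum (M : nat) v t : R[i] :=
  \sum_(i < M) rc (v i) * ckernel M (t - i%:R / M%:R).

Section fixM.
Variable M : nat.
Hypothesis M0 : (0 < M)%N.
Let m0 : 0 < M%:R :> R. Proof. by rewrite ltr0n. Qed.
Let mi : 0 < M%:R^-1 :> R. Proof. by rewrite invr_gt0. Qed.

Lemma cpi_ge1 : 1 <= cpi.
Proof. by rewrite /cpi lerDl sqr_ge0. Qed.
Let cpi0 : 0 < cpi. Proof. exact: lt_le_trans cpi_ge1. Qed.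

Lemma cradius_itv : 0 <= cradius M <= 1.
Proof. by rewrite /cradius subr_ge0 invf_le1// ler1n M0/= gerBl ltW. Qed.

Lemma Re_cden t : M%:R^-1 <= complex.Re (cden M t).
Proof.
have /andP[r0 r1] := cradius_itv.
rewrite /cden cReD cReN Re_rcM /=.
have := cos_le1 (2 * pi * 1 * t); move: (cos _) => c c1.
have : cradius M * c <= cradius M by rewrite -[leRHS]mulr1 ler_wpM2l.
rewrite {2}/cradius; lra.
Qed.

Lemma cabs_cden_ge t : M%:R^-1 <= cabs (cden M t).
Proof. exact: le_trans (Re_cden t) (Re_le _). Qed.

Let cden0 t : 0 < cabs (cden M t). Proof. exact: lt_le_trans (cabs_cden_ge t). Qed.

Lemma Re_ckernel t :
  complex.Re (ckernel M t) = cpi / M%:R * (complex.Re (cden M t) / cabs (cden M t) ^+ 2).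
Proof. by rewrite Re_rcM cReV. Qed.

(** The bound degenerates as M grows. It only expresses positivity: the constant produced by
    [logreg_cabs] does not depend on it. *)
Lemma Re_ckernel_lb : exists2 d : R, 0 < d & forall t, d <= complex.Re (ckernel M t).
Proof.
exists (cpi / M%:R * (M%:R^-1 / 2 ^+ 2)); first by rewrite !mulr_gt0 ?invr_gt0.
move=> t; rewrite Re_ckernel ler_pM2l ?divr_gt0//.
have h : cabs (cden M t) <= 2.
  apply: (le_trans (cabsB _ _)); rewrite cabs1 cabsM cabs_expi mulr1 cabs_rc.
  by have /andP[r0 r1] := cradius_itv; rewrite ger0_norm// -[leRHS]/(1 + 1) lerD2l.
apply: ler_pM; rewrite ?(ltW mi) ?invr_ge0 ?Re_cden ?sqr_ge0//.
by rewrite lef_pV2 ?posrE ?exprn_gt0// lerXn2r// nnegrE ltW.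
Qed.

(** Origin of [cpi]: with r = 1 - 1/M, |1 - r e^(2 pi i t)|^2 = (1 - r)^2 + 2r (1 - cos (2 pi t)) is
    at most (1 + (2 pi)^2) / M^2 for |t| <= 1/M, while the real part of the denominator is at least
    1/M. *)
Lemma Re_ckernel_near t : `|t| <= M%:R^-1 -> 1 <= complex.Re (ckernel M t).
Proof.
move=> tM; rewrite Re_ckernel.
have h : cabs (cden M t) ^+ 2 <= cpi * M%:R^-1 ^+ 2.
  rewrite sqr_cabs /cden cReD cImD cReN cImN Re_rcM Im_rcM /= mulr1.
  have := cos2Dsin2 (2 * pi * t); have /andP[+ +] := cos_bound (2 * pi * t).
  have /andP[r0 r1] := cradius_itv.
  have t2 : t ^+ 2 <= M%:R^-1 ^+ 2.
    by rewrite -(real_normK (num_real t)) lerXn2r// nnegrE ltW.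
  have -> : M%:R^-1 = 1 - cradius M :> R by rewrite /cradius; ring.
  move: t2; have -> : M%:R^-1 = 1 - cradius M :> R by rewrite /cradius; ring.
  rewrite /cpi exprMn.
  move: (cradius M) r0 r1 => r r0 r1; set c := cos _; set s' := sin _.
  move: ((2 * pi) ^+ 2) (sqr_ge0 (2 * pi : R)) => p p0 t2 c1 c2 cs.
  have pt : p * t ^+ 2 <= p * (1 - r) ^+ 2 by rewrite ler_wpM2l.
  apply: (@le_trans _ _ ((1 - r) ^+ 2 + p * t ^+ 2)); last by rewrite mulrDl mul1r lerD2l.
  have -> : (1 - r * c) ^+ 2 + (0 - r * s') ^+ 2 =
    1 - 2 * r * c + r ^+ 2 * (c ^+ 2 + s' ^+ 2) by ring.
  rewrite cs; have : 2 * r * (1 - c) <= 1 * (p * t ^+ 2).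
    rewrite -mulrA mulrCA; apply: ler_pM => //; first by rewrite mulr_ge0//; lra.
    lra.
  rewrite !expr2; lra.
apply: (@le_trans _ _ (cpi / M%:R * (M%:R^-1 / (cpi * M%:R^-1 ^+ 2)))).
  by rewrite le_eqVlt; apply/orP; left; apply/eqP; field; rewrite !gt_eqF.
rewrite ler_pM2l ?divr_gt0//; apply: ler_pM; rewrite ?invr_ge0 ?Re_cden//.
- by rewrite mulr_ge0 ?sqr_ge0 ?ltW.
- by rewrite lef_pV2 ?posrE ?exprn_gt0// mulr_gt0// exprn_gt0.
Qed.

Lemma disc_ckernel s : disc (fun t => ckernel M (t - s)).
Proof.
apply: discM (disc_cst _) _; apply: (@disc_inv _ _ M%:R^-1) => //.
  by move=> t; exact: Re_cden.
apply: discB (disc_cst _) (discM (disc_cst _) (disc_translate_expi _)).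
Qed.

Definition charnack : R := 2 * pi * (1 + 2 * pi).

Lemma charnack_ge0 : 0 <= charnack.
Proof. by rewrite /charnack; have := @pi_ge0 R; nra. Qed.

(** The difference of the kernels is the difference of the denominators, at most 2 pi / M <= 2 pi Re
    [cden M s], over their product; and |[cden M s]| <= (1 + 2 pi) |[cden M t]|. Bounding by the
    real part, not the modulus, matters: real parts add without cancellation against nonnegative
    data, which gives [cauchy_harnack]. *)
Lemma ckernel_harnack t s : `|t - s| <= M%:R^-1 ->
  cabs (ckernel M t - ckernel M s) <= charnack * complex.Re (ckernel M s).
Proof.
move=> ts; have ets := cabs_expiB_le t s.
have /andP[r0 r1] := cradius_itv.
have p0 : 0 <= 2 * pi :> R by rewrite mulr_ge0 ?pi_ge0.
have e1 : cabs (expi 1 t - expi 1 s) <= 2 * pi * M%:R^-1.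
  by apply: (le_trans ets); rewrite ler_wpM2l.
have dE : cden M s - cden M t = rc (cradius M) * (expi 1 t - expi 1 s).
  by rewrite /cden; ring.
have dst : cabs (cden M s - cden M t) <= 2 * pi * M%:R^-1.
  rewrite dE cabsM cabs_ge0_rc// -[leRHS]mul1r; apply: ler_pM => //; exact: cabs_ge0.
have Dst : cabs (cden M s) <= (1 + 2 * pi) * cabs (cden M t).
  rewrite -(subrK (cden M t) (cden M s)) addrC mulrDl mul1r.
  apply: (le_trans (cabsD _ _)); rewrite lerD2l; apply: (le_trans dst).
  by rewrite ler_wpM2l// cabs_cden_ge.
have -> : ckernel M t - ckernel M s =
   rc (cpi / M%:R) * ((cden M s - cden M t) * ((cden M t)^-1 * (cden M s)^-1)).
  rewrite /ckernel; have ? : cden M s != 0 by rewrite -cabs_gt0.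
  have ? : cden M t != 0 by rewrite -cabs_gt0.
  by rewrite -mulrBr; congr (_ * _); field; apply/andP; split.
have cM0 : 0 < cpi / M%:R by rewrite divr_gt0.
rewrite Re_ckernel cabsM (cabs_ge0_rc (ltW cM0)).
rewrite [leRHS]mulrCA ler_pM2l// !cabsM !cabsV.
rewrite /charnack; set a := cabs (cden M t); set b := cabs (cden M s).
have a0 : 0 < a := cden0 t; have b0 : 0 < b := cden0 s.
apply: (@le_trans _ _ ((2 * pi * complex.Re (cden M s)) * ((1 + 2 * pi) / b ^+ 2))).
  apply: ler_pM; [exact: cabs_ge0|by rewrite mulr_ge0// invr_ge0 cabs_ge0| |].
    by apply: (le_trans dst); rewrite ler_wpM2l// Re_cden.
  rewrite expr2 invfM mulrA ler_pM2r ?invr_gt0// ler_pdivlMr//.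
  by rewrite mulrC ler_pdivrMr.
by rewrite le_eqVlt; apply/orP; left; apply/eqP; ring.
Qed.

Lemma cauchyD v w t : cauchy_sum M (fun i => v i + w i) t = cauchy_sum M v t + cauchy_sum M w t.
Proof. by rewrite /cauchy_sum -big_split; apply: eq_bigr => i _; rewrite rcD mulrDl. Qed.

Lemma disc_cauchy v : disc (cauchy_sum M v).
Proof. by apply: disc_sum => i _; apply: discM (disc_cst _) (disc_ckernel _). Qed.

Lemma Re_cauchy v t : complex.Re (cauchy_sum M v t) =
  \sum_(i < M) v i * complex.Re (ckernel M (t - i%:R / M%:R)).
Proof. by rewrite cRe_sum; apply: eq_bigr => i _; rewrite Re_rcM. Qed.

Lemma Re_cauchy_gt0 v : (forall i, 0 < v i) ->
  exists2 d : R, 0 < d & forall t, d <= complex.Re (cauchy_sum M v t).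
Proof.
move=> v0; have [d d0 dk] := Re_ckernel_lb.
exists (\sum_(i < M) v i * d).
  rewrite (bigD1 (Ordinal M0))//= ltr_pwDl ?mulr_gt0// sumr_ge0// => i _.
  by rewrite mulr_ge0 ?ltW.
by move=> t; rewrite Re_cauchy; apply: ler_sum => i _; rewrite ler_pM2l.
Qed.

Let Re_ck0 t : 0 <= complex.Re (ckernel M t).
Proof. by have [d d0 dk] := Re_ckernel_lb; exact: le_trans (ltW d0) (dk t). Qed.

Lemma Re_cauchy_ge v j t : (forall i, 0 <= v i) -> (j < M)%N ->
  `|t - j%:R / M%:R| <= M%:R^-1 -> v j <= complex.Re (cauchy_sum M v t).
Proof.
move=> v0 jM tj; rewrite Re_cauchy (bigD1 (Ordinal jM))//=.
rewrite -[leLHS]addr0; apply: lerD; last by apply: sumr_ge0 => i _; rewrite mulr_ge0 ?v0 ?Re_ck0.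
by rewrite -[leLHS]mulr1 ler_wpM2l// Re_ckernel_near.
Qed.

Lemma cauchy_harnack v t s : (forall i, 0 <= v i) -> `|t - s| <= M%:R^-1 ->
  cabs (cauchy_sum M v t) <= (1 + charnack) * cabs (cauchy_sum M v s).
Proof.
move=> v0 ts; rewrite -(subrK (cauchy_sum M v s) (cauchy_sum M v t)) addrC.
apply: (le_trans (cabsD _ _)); rewrite mulrDl mul1r lerD2l.
apply: (@le_trans _ _ (charnack * complex.Re (cauchy_sum M v s))); last first.
  by rewrite ler_wpM2l ?charnack_ge0// Re_le.
rewrite Re_cauchy /cauchy_sum -sumrB mulr_sumr; apply: (le_trans (cabs_sum_le _ _ _)).
apply: ler_sum => i _; rewrite -mulrBr cabsM cabs_ge0_rc// mulrCA ler_wpM2l//.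
by apply: ckernel_harnack; rewrite opprD addrACA subrr addr0.
Qed.

(** From 1 - 1/M <= exp (-1/M) and e >= 2. It keeps 1 - r^M above 1/2, whence the factor 2 in
    [cauchy_l2]. *)
Lemma cradius_expn : cradius M ^+ M <= 1 / 2.
Proof.
have /andP[r0 r1] := cradius_itv.
apply: (@le_trans _ _ (expR (- M%:R^-1) ^+ M)).
  by rewrite lerXn2r ?nnegrE ?expR_ge0// expR_ge1Dx.
rewrite -expRM_natl mulrN mulfV ?gt_eqF// expRN div1r lef_pV2 ?posrE ?expR_gt0//.
exact: expR_ge1Dx.
Qed.

(* On the grid, [1 / (1 - r z) = (1 - r^M)^-1 sum_(k < M) r^k z^k] because
   [z^M = 1], so that [cauchy_sum] is a bounded Fourier multiplier on Z/M. *)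
Lemma cauchy_l2 v :
  \sum_(j < M) cabs (cauchy_sum M v (j%:R / M%:R)) ^+ 2 <=
  (2 * cpi) ^+ 2 * \sum_(j < M) v j ^+ 2.
Proof.
have /andP[r0 r1] := cradius_itv.
pose om : R[i] := expi 1 M%:R^-1; pose omc : R[i] := conjc om.
have om1 : cabs om = 1 by exact: cabs_expi.
have omM : om ^+ M = 1 by rewrite -expi_natM mulfV ?gt_eqF// (expi_nat _ 1).
have omd d : (0 < d < M)%N -> om ^+ d != 1.
  move=> /andP[d0 dM]; rewrite -expi_natM; apply: expi_neq1.
  by rewrite mulr_gt0 ?ltr0n//= ltr_pdivrMr// mul1r ltr_nat.
have omcX d : omc ^+ d = conjc (om ^+ d) by rewrite rmorphXn.
have omc1 : cabs omc = 1 by rewrite cabs_conjc.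
have omcM : omc ^+ M = 1 by rewrite omcX omM rmorph1.
have omcd d : (0 < d < M)%N -> omc ^+ d != 1.
  move=> dM; rewrite omcX; apply: contra (omd d dM) => /eqP h.
  by rewrite -(conjcK (om ^+ d)) h rmorph1.
pose r := cradius M.
(* Fourier coefficients of [v] on Z/M, damped by r^k <= 1. Parseval with [om] passes from T v to
   [g], Parseval with [omc] from [g] to [v]; each costs a factor M, so the squared norm is at most
   (A M)^2. *)
pose g (k : nat) : R[i] := rc (r ^+ k) * \sum_(i < M) rc (v i) * omc ^+ (k * i).
pose A : R := cpi / M%:R * (1 - r ^+ M)^-1.
have rM : r ^+ M <= 1 / 2 := cradius_expn.
have rM0 : 0 < 1 - r ^+ M by lra.
have A0 : 0 <= A by rewrite mulr_ge0 ?divr_ge0 ?invr_ge0 ?(ltW rM0) ?(ltW cpi0)// ltW.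
have TE (j : nat) : cauchy_sum M v (j%:R / M%:R) =
    rc A * \sum_(k < M) g k * om ^+ (j * k).
  rewrite /cauchy_sum /A rcM -mulrA mulr_sumr.
  have ker (i : nat) : ckernel M (j%:R / M%:R - i%:R / M%:R) =
     rc (cpi / M%:R) * (rc (1 - r ^+ M)^-1 *
       \sum_(k < M) rc (r ^+ k) * (om ^+ (j * k) * omc ^+ (k * i))).
    rewrite /ckernel; congr (_ * _).
    set z := om ^+ j * omc ^+ i.
    have -> : cden M (j%:R / M%:R - i%:R / M%:R) = 1 - rc r * z.
      rewrite /cden -/r; congr (_ - _ * _).
      by rewrite expi_D expiN !expi_natM /z omcX.
    have zM : z ^+ M = 1.
      by rewrite /z exprMn -!exprM ![(_ * M)%N]mulnC !exprM omM omcM !expr1n mulr1.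
    have -> : \sum_(k < M) rc (r ^+ k) * (om ^+ (j * k) * omc ^+ (k * i)) =
       \sum_(k < M) (rc r * z) ^+ k.
      apply: eq_bigr => k _; rewrite exprMn rcX; congr (_ * _).
      by rewrite /z exprMn -!exprM [(i * k)%N]mulnC.
    have E : (1 - rc r * z) * \sum_(k < M) (rc r * z) ^+ k = rc (1 - r ^+ M).
      have := subrX1 (rc r * z) M; rewrite exprMn zM mulr1 -rcX => h.
      by rewrite -opprB mulNr -h opprB rcB.
    have n0 : rc (1 - r ^+ M) != 0.
      by rewrite -cabs_gt0 cabs_rc normr_gt0 gt_eqF.
    have d0 : 1 - rc r * z != 0.
      by apply/eqP => d0; move: E n0; rewrite d0 mul0r => <-; rewrite eqxx.
    rewrite rcV -E invfM -mulrA mulVf ?mulr1//.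
    by apply/eqP => s0; move: E n0; rewrite s0 mulr0 => <-; rewrite eqxx.
  transitivity (\sum_(i < M) \sum_(k < M) rc (cpi / M%:R) * rc (1 - r ^+ M)^-1 *
    (rc (r ^+ k) * (rc (v i) * omc ^+ (k * i)) * om ^+ (j * k))).
    apply: eq_bigr => i _; rewrite ker mulrA mulrA [rc (v i) * _]mulrC.
    rewrite -!mulrA !mulr_sumr; apply: eq_bigr => k _; ring.
  rewrite exchange_big /= mulr_sumr; apply: eq_bigr => k _.
  rewrite /g mulr_sumr mulr_suml !mulr_sumr; apply: eq_bigr => i _; ring.
have -> : \sum_(j < M) cabs (cauchy_sum M v (j%:R / M%:R)) ^+ 2 =
   A ^+ 2 * (M%:R * \sum_(k < M) cabs (g k) ^+ 2).
  rewrite -(parseval_finite _ om1 omM omd) mulr_sumr; apply: eq_bigr => j _.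
  by rewrite TE cabsM cabs_ge0_rc// exprMn.
have gle : \sum_(k < M) cabs (g k) ^+ 2 <= M%:R * \sum_(j < M) v j ^+ 2.
  have -> : \sum_(j < M) v j ^+ 2 = \sum_(j < M) cabs (rc (v j)) ^+ 2.
    by apply: eq_bigr => i _; rewrite cabs_rc real_normK ?num_real.
  rewrite -(parseval_finite (fun i => rc (v i)) omc1 omcM omcd); apply: ler_sum => k _.
  rewrite lerXn2r ?nnegrE ?cabs_ge0// /g cabsM cabs_ge0_rc ?exprn_ge0//.
  by rewrite -[leRHS]mul1r ler_wpM2r ?cabs_ge0// exprn_ile1.
have AM : A * M%:R <= 2 * cpi.
  have -> : A * M%:R = cpi / (1 - r ^+ M) by rewrite /A; field; rewrite !gt_eqF.
  rewrite ler_pdivrMr// -mulrA mulrC -mulrA -[leLHS]mulr1 ler_pM2l//; lra.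
apply: (@le_trans _ _ ((A * M%:R) ^+ 2 * \sum_(j < M) v j ^+ 2)).
  clearbody A; move: gle; set S1 := \sum_(k < M) _; set S2 := \sum_(j < M) _ => gle.
  have -> : (A * M%:R) ^+ 2 * S2 = A ^+ 2 * (M%:R * (M%:R * S2)) by ring.
  rewrite ler_wpM2l ?sqr_ge0//.
  by rewrite ler_wpM2l// ltW.
have A1 : 0 <= A * M%:R by rewrite mulr_ge0// ltW.
apply: ler_wpM2r; first by apply: sumr_ge0 => i _; exact: sqr_ge0.
by rewrite lerXn2r// nnegrE// mulr_ge0// ltW.
Qed.

End fixM.
End DiscreteCauchy.

(** * Majorants with regular logarithm *)

Section Majorants.
Set Implicit Arguments. Unset Strict Implicit. Unset Printing Implicit Defensive.
Variable R : realType.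
Implicit Types (p q : \bar R) (a b A v w : nat -> R) (t s : R).

(* [pbound p N 1 a X]: the norm of [a] in l_p^N is at most [X]; with [c] = N,
   the same for the normalized counting measure.  Infinite [p] means sup. *)
Definition pbound p (N : nat) (c : R) a (X : R) : Prop :=
  match p with
  | EFin r => \sum_(n < N) a n `^ r <= c * X `^ r
  | _ => forall n, (n < N)%N -> a n <= X
  end.

Definition nearpt (M j : nat) t := `|t - j%:R / M%:R| <= M%:R^-1.

Lemma le_powR2 (s x y : R) : 0 <= s -> 0 <= x -> x <= y -> x `^ s <= y `^ s.
Proof.
by move=> s0 x0 xy; rewrite ge0_ler_powR// nnegrE// (le_trans x0).
Qed.

Lemma pbound_scale p N (c k : R) a X : 0 <= k -> (forall n, 0 <= a n) -> 0 <= X ->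
  pbound p N c a X -> pbound p N c (fun n => k * a n) (k * X).
Proof.
move=> k0 a0 X0; case: p => [r| |] /= h; last 2 first.
- by move=> n /h; exact: ler_wpM2l.
- by move=> n /h; exact: ler_wpM2l.
under eq_bigr do rewrite powRM//.
by rewrite -mulr_sumr powRM// mulrCA ler_wpM2l// powR_ge0.
Qed.

Lemma pbound_mono p N (c : R) a b X : (0 <= p)%E ->
  (forall n, (n < N)%N -> 0 <= a n <= b n) -> pbound p N c b X -> pbound p N c a X.
Proof.
case: p => [r| |] //= r0 ab; last by move=> h n nN; have /andP[_ /le_trans] := ab n nN; apply; exact: h.
apply: le_trans; apply: ler_sum => n _; have /andP[an0 anb] := ab n (ltn_ord n).
exact: le_powR2.
Qed.

Lemma pbound_leX p N (c : R) a X Y : (0 <= p)%E -> 0 <= c -> 0 <= X <= Y ->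
  pbound p N c a X -> pbound p N c a Y.
Proof.
case: p => [r| |] //= r0 c0 /andP[X0 XY]; last by move=> h n /h /le_trans; apply.
move/le_trans; apply; by rewrite ler_wpM2l// le_powR2.
Qed.

Lemma sqr_powR_half (x r : R) : 0 <= x -> (x `^ (r / 2)) ^+ 2 = x `^ r.
Proof. by move=> x0; rewrite -powR_mulrn ?powR_ge0// -powRrM divfK. Qed.

Lemma powR_half_inv (x r : R) : 0 < r -> 0 <= x -> (x `^ (r / 2)) `^ (2 / r) = x.
Proof.
move=> r0 x0; rewrite -powRrM (_ : r / 2 * (2 / r) = 1) ?powRr1//.
by field; rewrite gt_eqF.
Qed.

Lemma powR_two_div (x r : R) : 0 < r -> 0 <= x -> (x `^ (2 / r)) `^ r = x ^+ 2.
Proof. by move=> r0 x0; rewrite -powRrM divfK ?gt_eqF// powR_mulrn. Qed.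

Definition hc : R := 1 + charnack R.

Lemma hc_ge1 : 1 <= hc.
Proof. by rewrite /hc lerDl charnack_ge0. Qed.
Let hc0 : 0 < hc. Proof. exact: lt_le_trans hc_ge1. Qed.

(** The power r/2 turns the l_r bound on A into an l_2 bound on [y], so r = 1 is no exception; for
    infinite p the constant X is a majorant. The lower bound is [Re_cauchy_ge]. The numbers [b]
    bound [w] on a whole neighbourhood of each grid point, at the price of the Harnack factor
    [hc]. *)
Lemma scalar_majorant p : (1 <= p)%E -> exists C K : R, 0 < C /\
  forall M A (X : R), (0 < M)%N -> (forall j, 0 < A j) -> 0 < X ->
  pbound p M M%:R A X ->
  exists (w : R -> R) b, [/\ forall t, 0 < w t, logreg K w, forall j, 0 <= b j,
    forall j t, (j < M)%N -> nearpt M j t -> A j <= w t <= b j &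
    pbound p M M%:R b (C * X)].
Proof.
case: p => [r| |]//; last first.
  move=> _; exists 1, 0; split=> // M A X M0 A0 X0 AX.
  exists (fun=> X), (fun=> X); split=> //.
  - exact: logreg_cst.
  - by move=> j; exact: ltW.
  - by move=> j t jM _; rewrite lexx andbT; exact: AX.
  - by move=> j jM; rewrite mul1r.
rewrite lee_fin => r1; have r0 : 0 < r by exact: lt_le_trans r1.
have cpi0 : 0 < cpi R := lt_le_trans ltr01 (@cpi_ge1 R).
pose D := hc * (2 * cpi R); have D0 : 0 < D by rewrite !mulr_gt0.
exists (D `^ (2 / r)), (`|2 / r| * 5); split; first exact: powR_gt0.
move=> M A X M0 A0 X0 AX; pose y j := A j `^ (r / 2).
have y0 j : 0 < y j by exact: powR_gt0.
have y0' j : 0 <= y j by exact: ltW.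
have [d d0 dF] := Re_cauchy_gt0 M0 y0.
have F0 t : 0 < cabs (cauchy_sum M y t).
  by apply: lt_le_trans d0 _; apply: le_trans (dF t) (Re_le _).
exists (fun t => cabs (cauchy_sum M y t) `^ (2 / r)).
exists (fun j => (hc * cabs (cauchy_sum M y (j%:R / M%:R))) `^ (2 / r)); split.
- by move=> t; exact: powR_gt0.
- by apply: logreg_powR; apply: logreg_cabs d0 dF (disc_cauchy M0 _).
- by move=> j; exact: powR_ge0.
- move=> j t jM tj; apply/andP; split.
    rewrite -{1}(powR_half_inv r0 (ltW (A0 j))).
    apply: le_powR2; rewrite ?divr_ge0 ?(ltW r0) ?powR_ge0//.
    exact: le_trans (Re_cauchy_ge M0 y0' jM tj) (Re_le _).
  apply: le_powR2; rewrite ?divr_ge0 ?(ltW r0) ?cabs_ge0//.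
  exact: cauchy_harnack.
- rewrite /=; under eq_bigr do rewrite powR_two_div// ?mulr_ge0 ?cabs_ge0 ?(ltW hc0)// exprMn.
  rewrite -mulr_sumr powRM ?powR_ge0 ?(ltW X0)// powR_two_div ?(ltW D0)//.
  apply: (@le_trans _ _ (hc ^+ 2 * ((2 * cpi R) ^+ 2 * \sum_(j < M) y j ^+ 2))).
    by rewrite ler_wpM2l ?sqr_ge0//; exact: cauchy_l2.
  rewrite [leRHS]mulrCA [leLHS]mulrA -(exprMn 2 hc) -/D ler_wpM2l ?sqr_ge0//.
  by under eq_bigr do rewrite sqr_powR_half ?(ltW (A0 _))//.
Qed.

(** Induction through the triangle inequality in the plane: the root of u + v^2 is the modulus of
    sqrt u + i v. *)
Lemma minkowski2 (N : nat) (x y : nat -> R) :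
  (forall n, 0 <= x n) -> (forall n, 0 <= y n) ->
  Num.sqrt (\sum_(n < N) (x n + y n) ^+ 2) <=
  Num.sqrt (\sum_(n < N) x n ^+ 2) + Num.sqrt (\sum_(n < N) y n ^+ 2).
Proof.
move=> x0 y0; elim: N => [|N IH]; first by rewrite !big_ord0 sqrtr0 addr0.
rewrite !big_ord_recr /=.
have s0 (z : nat -> R) : 0 <= \sum_(n < N) z n ^+ 2.
  by apply: sumr_ge0 => i _; exact: sqr_ge0.
set X := \sum_(n < N) x n ^+ 2 in IH *; set Y := \sum_(n < N) y n ^+ 2 in IH *.
have cE (u v : R) : 0 <= u -> Num.sqrt (u + v ^+ 2) = cabs (Complex (Num.sqrt u) v).
  by move=> u0; rewrite /cabs /= sqr_sqrtr.
rewrite (cE X) ?s0// (cE Y) ?s0//.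
apply: le_trans (cabsD _ _); rewrite /cabs cReD cImD /=.
rewrite ler_sqrt; last by rewrite addr_ge0 ?sqr_ge0.
rewrite lerD2r -[leLHS]sqr_sqrtr; last first.
  by apply: sumr_ge0 => i _; exact: sqr_ge0.
by rewrite lerXn2r// nnegrE ?addr_ge0 ?sqrtr_ge0.
Qed.

(** * A single weight adapted to all coordinates *)

Section RubioDeFrancia.
Variables (M N : nat) (be : nat -> nat -> R).
Hypothesis M0 : (0 < M)%N.
Hypothesis be0 : forall n j, 0 <= be n j.
Hypothesis be1 : forall j, (j < M)%N -> \sum_(n < N) be n j ^+ 2 <= 1.

Let T v j : R := hc * cabs (cauchy_sum M v (j%:R / M%:R)).
Let Tn n v := T (fun j => be n j * v j).
(** One sublinear operator carries the scalar and the vector-valued condition together. The factor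
    [hc] inside [T] lets the value at a grid point bound the Cauchy sum at all nearby points. *)
Let S v j : R := Num.sqrt (\sum_(n < N) Tn n v j ^+ 2) + T v j.

Let T0 v j : 0 <= T v j. Proof. by rewrite mulr_ge0 ?cabs_ge0// ltW. Qed.
Let S0 v j : 0 <= S v j. Proof. by rewrite addr_ge0 ?sqrtr_ge0. Qed.

Let TD v w j : T (fun i => v i + w i) j <= T v j + T w j.
Proof. by rewrite /T -mulrDr ler_pM2l// cauchyD cabsD. Qed.

Let TnD n v w j : Tn n (fun i => v i + w i) j <= Tn n v j + Tn n w j.
Proof.
apply: le_trans (TD _ _ _); rewrite /Tn le_eqVlt; apply/orP; left; apply/eqP.
by congr (T _ j); apply/funext => i; rewrite mulrDr.
Qed.

Let SD v w j : S (fun i => v i + w i) j <= S v j + S w j.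
Proof.
rewrite /S addrACA; apply: lerD => //.
apply: le_trans (@minkowski2 N (fun n => Tn n v j) (fun n => Tn n w j)
  (fun n => T0 _ j) (fun n => T0 _ j)).
rewrite ler_sqrt; last by apply: sumr_ge0 => n _; exact: sqr_ge0.
by apply: ler_sum => n _; rewrite lerXn2r ?nnegrE ?addr_ge0 ?T0 ?TnD.
Qed.

Let G : R := 2 * (hc * (2 * cpi R)).
Let cpi0 : 0 < cpi R := lt_le_trans ltr01 (@cpi_ge1 R).
Let G1 : 1 <= G.
Proof.
rewrite /G -[leLHS]mulr1; apply: ler_pM => //; first by rewrite ler1n.
rewrite -[leLHS]mulr1; apply: ler_pM; rewrite ?hc_ge1//.
by rewrite -[leLHS]mulr1; apply: ler_pM; rewrite ?cpi_ge1 ?ler1n.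
Qed.
Let G0 : 0 < G. Proof. exact: lt_le_trans G1. Qed.

Let T_l2 v : \sum_(j < M) T v j ^+ 2 <= (hc * (2 * cpi R)) ^+ 2 * \sum_(j < M) v j ^+ 2.
Proof.
under eq_bigr do rewrite exprMn.
by rewrite -mulr_sumr (exprMn 2 hc) -[leRHS]mulrA ler_wpM2l ?sqr_ge0//; exact: cauchy_l2.
Qed.

(** After exchanging the sums over n and j, the hypothesis sum_n be_n^2 <= 1 makes the bound
    independent of N. The 2 in [G] comes from (x + y)^2 <= 2 x^2 + 2 y^2 applied to two terms of the
    same size. *)
Let S_l2 v : \sum_(j < M) S v j ^+ 2 <= G ^+ 2 * \sum_(j < M) v j ^+ 2.
Proof.
pose g := hc * (2 * cpi R).
apply: (@le_trans _ _ (\sum_(j < M) (2 * \sum_(n < N) Tn n v j ^+ 2 + 2 * T v j ^+ 2))).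
  apply: ler_sum => j _; rewrite /S.
  set x := \sum_(n < N) _; set y := T v j.
  have x0 : 0 <= x by apply: sumr_ge0 => n _; exact: sqr_ge0.
  rewrite -[in leRHS](sqr_sqrtr x0); move: (Num.sqrt x) => z.
  by have := sqr_ge0 (z - y); rewrite !expr2; lra.
rewrite big_split /= -!mulr_sumr exchange_big /=.
apply: (@le_trans _ _ (2 * (g ^+ 2 * \sum_(j < M) v j ^+ 2) +
                       2 * (g ^+ 2 * \sum_(j < M) v j ^+ 2))); last first.
  by rewrite /G -/g le_eqVlt; apply/orP; left; apply/eqP; ring.
apply: lerD; rewrite ler_pM2l//.
apply: (@le_trans _ _ (\sum_(n < N) g ^+ 2 * \sum_(j < M) (be n j * v j) ^+ 2)).
  by apply: ler_sum => n _; exact: T_l2.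
rewrite -mulr_sumr ler_wpM2l ?sqr_ge0// exchange_big /=.
apply: ler_sum => j _; under eq_bigr do rewrite exprMn.
by rewrite -mulr_suml -[leRHS]mul1r ler_wpM2r ?sqr_ge0// be1.
Qed.

(** Dividing by twice the norm bound of S halves the l_2 norm bound at each step, starting from the
    norm sqrt M of the constant 1. *)
Let u := fix u k : nat -> R :=
  if k is k'.+1 then fun j => S (u k') j / (2 * G) else fun=> 1.

Let u0 k j : 0 <= u k j.
Proof. by case: k => [|k] //=; rewrite divr_ge0// mulr_ge0// ltW. Qed.

Let u_l2 k : \sum_(j < M) u k j ^+ 2 <= (1 / 2) ^+ k ^+ 2 * M%:R.
Proof.
elim: k => [|k IH].
  by rewrite /= expr0 expr1n mul1r sumr_const card_ord.
rewrite /=; under eq_bigr do rewrite exprMn.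
rewrite -mulr_suml exprVn ler_pdivrMr ?exprn_gt0 ?mulr_gt0//.
apply: (le_trans (S_l2 _)); apply: (@le_trans _ _ (G ^+ 2 * ((1 / 2) ^+ k ^+ 2 * M%:R))).
  by rewrite ler_wpM2l ?sqr_ge0.
rewrite le_eqVlt; apply/orP; left; apply/eqP; rewrite [_ ^+ k.+1]exprSr.
by move: ((1 / 2) ^+ k) G => h g; field.
Qed.

(* The finite Rubio de Francia iteration [v = sum_(k <= L) u_k]; the tail
   [u_(L+1)] is at most [1 = u_0 <= v] for large [L]. *)
Lemma rubio_de_francia : exists v, (forall j, 1 <= v j) /\
  forall j t, (j < M)%N -> nearpt M j t ->
    cabs (cauchy_sum M v t) <= 4 * G * v j /\
    \sum_(n < N) cabs (cauchy_sum M (fun i => be n i * v i) t) ^+ 2 <= (4 * G * v j) ^+ 2.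
Proof.
have h2 : (1 / 2 : R) < 1 by lra.
(* On a finite grid the sup norm is at most the l_2 norm, and 2^-L <= 1/M brings sqrt M 2^-(L+1)
   below 1. *)
have [L LM] := @geometric_small R (1 / 2) M%:R^-1 ltac:(lra) h2
  ltac:(by rewrite invr_gt0 ltr0n).
pose v j := \sum_(k < L.+1) u k j.
have v1 j : 1 <= v j by rewrite /v big_ord_recl /= lerDl; apply: sumr_ge0 => i _; exact: (u0 i.+1).
have Sv j : S v j <= \sum_(k < L.+1) S (u k) j.
  rewrite /v; elim: L {LM v v1} => [|L IH].
    rewrite big_ord1 le_eqVlt; apply/orP; left; apply/eqP.
    by congr (S _ j); apply/funext => i; rewrite big_ord1.
  rewrite [leRHS]big_ord_recr /=; apply: (@le_trans _ _ (S (fun j => \sum_(k < L.+1) u k j) j + S (u L.+1) j)).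
    apply: le_trans (SD _ _ _); rewrite le_eqVlt; apply/orP; left; apply/eqP.
    by congr (S _ j); apply/funext => i; rewrite big_ord_recr.
  by rewrite lerD2r.
have uL j : (j < M)%N -> u L.+1 j <= 1.
  move=> jM; rewrite -(@ler_pXn2r _ 2)// ?nnegrE// expr1n.
  apply: (@le_trans _ _ (\sum_(j < M) u L.+1 j ^+ 2)).
    rewrite (bigD1 (Ordinal jM))//= lerDl sumr_ge0// => i _; exact: sqr_ge0.
  apply: (le_trans (u_l2 _)); rewrite [_ ^+ L.+1]exprS.
  have a0 : 0 <= (1 / 2 : R) ^+ L by rewrite exprn_ge0.
  have a1 : (1 / 2 : R) ^+ L <= 1 by rewrite exprn_ile1// ltW.
  have M0' : 0 < M%:R :> R by rewrite ltr0n.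
  have : (1 / 2 : R) ^+ L * M%:R <= 1 by rewrite -ler_pdivlMr// [leRHS]mul1r.
  move: ((1 / 2 : R) ^+ L) a0 a1 => x x0 x1 xM.
  have : x * (x * M%:R) <= 1 by rewrite mulr_ile1// mulr_ge0// ltW.
  have -> : (1 / 2 * x) ^+ 2 * M%:R = x * (x * M%:R) / 4 by field.
  move: (x * (x * _)) => z; lra.
(* S v <= 2G (u_1 + ... + u_(L+1)). The first L terms sum to at most v and the last is at most 1 <=
   v, which gives 2G (v + v). *)
have Sv2 j : (j < M)%N -> S v j <= 4 * G * v j.
  move=> jM; apply: (le_trans (Sv j)).
  have -> : \sum_(k < L.+1) S (u k) j = 2 * G * \sum_(k < L.+1) u k.+1 j.
    by rewrite mulr_sumr; apply: eq_bigr => k _ /=; rewrite mulrC divfK// gt_eqF// mulr_gt0.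
  have -> : 4 * G * v j = 2 * G * (v j + v j) by ring.
  rewrite ler_pM2l ?mulr_gt0//.
  rewrite big_ord_recr /=; apply: lerD.
    by rewrite /v [leRHS]big_ord_recl /= lerDr.
  exact: le_trans (uL j jM) (v1 j).
exists v; split=> // j t jM tj.
have v0 i : 0 <= v i by exact: le_trans (v1 i).
have TS : T v j <= S v j by rewrite lerDr sqrtr_ge0.
split.
  apply: le_trans (Sv2 _ jM); apply: le_trans TS; exact: cauchy_harnack.
apply: (@le_trans _ _ (\sum_(n < N) Tn n v j ^+ 2)).
  apply: ler_sum => n _; rewrite lerXn2r ?nnegrE ?cabs_ge0 ?T0//.
  by apply: cauchy_harnack => // i; rewrite mulr_ge0.
have s0 : 0 <= \sum_(n < N) Tn n v j ^+ 2 by apply: sumr_ge0 => n _; exact: sqr_ge0.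
rewrite -[leLHS](sqr_sqrtr s0) lerXn2r ?nnegrE ?sqrtr_ge0//.
  by rewrite !mulr_ge0// ltW.
by apply: le_trans (Sv2 _ jM); rewrite /S lerDl.
Qed.

End RubioDeFrancia.

(** Near grid point j both Cauchy sums are pinched: v <= |T v| <= D v and beta_n v <= |T (beta_n
    v)|. So D |T (beta_n v)| / |T v| >= beta_n, while its squares sum over n to at most D^2 (D v)^2
    / v^2 = D^4. The power 2/r returns from beta_n to alpha_n. For q infinite the weight 1 will
    do. *)
Lemma sequence_majorant q : (1 <= q)%E -> exists C K : R, 0 < C /\
  forall M N (al : nat -> nat -> R), (0 < M)%N -> (forall n j, 0 < al n j) ->
  (forall j, (j < M)%N -> pbound q N 1 (al^~ j) 1) ->
  exists w : nat -> R -> R, [/\ forall n t, 0 < w n t, forall n, logreg K (w n),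
    forall j t n, (j < M)%N -> nearpt M j t -> (n < N)%N -> al n j <= w n t &
    forall j t, (j < M)%N -> nearpt M j t -> pbound q N 1 (w^~ t) C].
Proof.
case: q => [r| |]//; last first.
  move=> _; exists 1, 0; split=> // M N al M0 al0 al1.
  exists (fun=> fun=> 1); split=> //.
  - by move=> n; exact: logreg_cst.
  - by move=> j t n jM _; exact: al1.
  - by move=> j t _ _ n _; exact: lexx.
rewrite lee_fin => r1; have r0 : 0 < r by exact: lt_le_trans r1.
have cpi0 : 0 < cpi R := lt_le_trans ltr01 (@cpi_ge1 R).
pose D := 4 * (2 * (hc * (2 * cpi R))); have D0 : 0 < D by rewrite !mulr_gt0.
exists ((D ^+ 2) `^ (2 / r)), (`|2 / r| * (0 + 5 + 5)); split.
  by rewrite powR_gt0 ?exprn_gt0.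
move=> M N al M0 al0 al1; pose be n j := al n j `^ (r / 2).
have be0 n j : 0 < be n j by exact: powR_gt0.
have [||v [v1 vD]] := @rubio_de_francia M N be M0.
- by move=> n j; exact: ltW.
- move=> j jM; have /= := al1 j jM; rewrite mul1r powR1.
  by under [in X in _ -> X]eq_bigr do rewrite sqr_powR_half ?(ltW (al0 _ _))//.
rewrite -/D in vD; clearbody D.
have v0 j : 0 < v j by exact: lt_le_trans (v1 j).
have v0' j : 0 <= v j by exact: ltW.
have bv0 n j : 0 < be n j * v j by rewrite mulr_gt0.
have bv0' n j : 0 <= be n j * v j by exact: ltW.
pose En n := cauchy_sum M (fun i => be n i * v i); pose E := cauchy_sum M v.
have [d d0 dE] := Re_cauchy_gt0 M0 v0.
have E0 t : 0 < cabs (E t).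
  by apply: lt_le_trans d0 _; apply: le_trans (dE t) (Re_le _).
have En0 n t : 0 < cabs (En n t).
  have [dn dn0 dEn] := Re_cauchy_gt0 M0 (bv0 n).
  by apply: lt_le_trans dn0 _; apply: le_trans (dEn t) (Re_le _).
exists (fun n t => (D * cabs (En n t) * (cabs (E t))^-1) `^ (2 / r)); split.
- by move=> n t; rewrite powR_gt0// !mulr_gt0 ?invr_gt0.
- move=> n; apply: logreg_powR; apply: logregM.
  + by move=> t; rewrite mulr_gt0.
  + by move=> t; rewrite invr_gt0.
  + apply: logregM => //; first exact: logreg_cst.
    have [dn dn0 dEn] := Re_cauchy_gt0 M0 (bv0 n).
    exact: logreg_cabs dn0 dEn (disc_cauchy M0 _).
  + by apply: logregV => //; exact: logreg_cabs d0 dE (disc_cauchy M0 _).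
- move=> j t n jM tj nN.
  rewrite -{1}(powR_half_inv r0 (ltW (al0 n j))).
  apply: le_powR2; rewrite ?divr_ge0 ?(ltW r0) ?powR_ge0//.
  rewrite ler_pdivlMr// -/(be n j); have [h _] := vD j t jM tj.
  apply: (@le_trans _ _ (be n j * (D * v j))); first by rewrite ler_pM2l.
  rewrite mulrCA ler_pM2l//.
  exact: le_trans (Re_cauchy_ge M0 (bv0' n) jM tj) (Re_le _).
- move=> j t jM tj /=; have [_ h] := vD j t jM tj.
  have sq n : ((D * cabs (En n t) * (cabs (E t))^-1) `^ (2 / r)) `^ r =
      D ^+ 2 / cabs (E t) ^+ 2 * cabs (En n t) ^+ 2.
    rewrite powR_two_div//; last by rewrite ltW// !mulr_gt0 ?invr_gt0.
    by field; rewrite gt_eqF.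
  under eq_bigr do rewrite sq.
  rewrite powR_two_div ?exprn_ge0 ?(ltW D0)// mul1r -mulr_sumr.
  rewrite mulrAC ler_pdivrMr ?exprn_gt0// [(D ^+ 2) ^+ 2]expr2 -[leRHS]mulrA.
  rewrite ler_pM2l ?exprn_gt0//.
  apply: (le_trans h); rewrite -[D ^+ 2 * _](exprMn 2 D) lerXn2r ?nnegrE ?mulr_ge0 ?cabs_ge0 ?(ltW D0)//.
  rewrite ler_pM2l//.
  exact: le_trans (Re_cauchy_ge M0 v0' jM tj) (Re_le _).
Qed.

(** The product of a majorant of [A] and of one for the normalized sequence [a n j / A j]. C and K
    are chosen before M and N: this uniformity is what the final approximation relies on. *)
Lemma mixed_majorant p q : (1 <= p)%E -> (1 <= q)%E -> exists C K : R, 0 < C /\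
  forall M N (a : nat -> nat -> R) A (X : R),
  (0 < M)%N -> (forall n j, 0 < a n j) -> (forall j, 0 < A j) -> 0 < X ->
  (forall j, (j < M)%N -> pbound q N 1 (a^~ j) (A j)) ->
  pbound p M M%:R A X ->
  exists (w : nat -> R -> R) b, [/\ forall n t, 0 < w n t, forall n, logreg K (w n),
    forall j t n, (j < M)%N -> nearpt M j t -> (n < N)%N -> a n j <= w n t,
    forall j t, (j < M)%N -> nearpt M j t -> pbound q N 1 (w^~ t) (b j) &
    (forall j, 0 <= b j) /\ pbound p M M%:R b (C * X)].
Proof.
move=> p1 q1; have [C1 [K1 [C10 H1]]] := scalar_majorant p1.
have [C2 [K2 [C20 H2]]] := sequence_majorant q1.
have p0 : (0 <= p)%E by exact: le_trans p1.
have q0 : (0 <= q)%E by exact: le_trans q1.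
exists (C2 * C1), (K1 + K2); split; first exact: mulr_gt0.
move=> M N a A X M0 a0 A0 X0 aA AX.
have [om [b [om0 omK b0 Aom bX]]] := H1 M A X M0 A0 X0 AX.
have [||w [w0 wK aw wC]] := H2 M N (fun n j => (A j)^-1 * a n j) M0.
- by move=> n j; rewrite mulr_gt0 ?invr_gt0.
- move=> j jM; rewrite -[X in pbound _ _ _ _ X](mulVf (lt0r_neq0 (A0 j))); apply: pbound_scale.
  + by rewrite invr_ge0 ltW.
  + by move=> n; exact: ltW.
  + exact: ltW.
  + exact: aA.
exists (fun n t => om t * w n t), (fun j => C2 * b j); split.
- by move=> n t; rewrite mulr_gt0.
- by move=> n; apply: logregM.
- move=> j t n jM tj nN; have := aw j t n jM tj nN.
  rewrite mulrC ler_pdivrMr// mulrC => /le_trans; apply.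
  by rewrite ler_pM2r//; have /andP[] := Aom j t jM tj.
- move=> j t jM tj; have /andP[_ omb] := Aom j t jM tj.
  rewrite mulrC; apply: (@pbound_mono _ _ _ _ (fun n => b j * w n t)) => //.
    move=> n _; rewrite mulr_ge0 ?(ltW (om0 _)) ?(ltW (w0 _ _))//=.
    by rewrite ler_wpM2r// ltW.
  apply: pbound_scale => //; [by move=> n; exact: ltW|exact: ltW|exact: wC j t jM tj].
- split; first by move=> j; rewrite mulr_ge0// ltW.
  rewrite -mulrA; apply: pbound_scale => //; first exact: ltW.
  by rewrite mulr_ge0 ?(ltW C10) ?(ltW X0).
Qed.

End Majorants.

(** * Splitting an analytic sequence along two majorants *)

Section AnalyticSplit.
Set Implicit Arguments. Unset Strict Implicit. Unset Printing Implicit Defensive.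
Variable R : realType.

(* [z0 = G (1 - Phi)] and [z1 = G Phi], with the cutoff [Phi] of the quotient of
   the two majorants. *)
Lemma analytic_split (p0 p1 q0 q1 : \bar R) :
  (1 <= p0)%E -> (1 <= p1)%E -> (1 <= q0)%E -> (1 <= q1)%E ->
  exists2 C : R, 0 < C & forall M N (a0 a1 : nat -> nat -> R) (A0 A1 : nat -> R)
    (X0 X1 : R) (G : nat -> R -> R[i]),
  (0 < M)%N -> 0 < X0 -> 0 < X1 ->
  (forall n j, 0 < a0 n j) -> (forall n j, 0 < a1 n j) ->
  (forall j, 0 < A0 j) -> (forall j, 0 < A1 j) ->
  (forall j, (j < M)%N -> pbound q0 N 1 (a0^~ j) (A0 j)) ->
  (forall j, (j < M)%N -> pbound q1 N 1 (a1^~ j) (A1 j)) ->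
  pbound p0 M M%:R A0 X0 -> pbound p1 M M%:R A1 X1 ->
  (forall n, disc (G n)) ->
  (forall j t n, (j < M)%N -> nearpt M j t -> (n < N)%N ->
     cabs (G n t) <= a0 n j + a1 n j) ->
  exists (z0 z1 : nat -> R -> R[i]) (b0 b1 : nat -> R),
  [/\ forall n, disc (z0 n) /\ disc (z1 n),
      forall n t, G n t = z0 n t + z1 n t,
      forall n, (forall t, G n t = 0) -> forall t, z0 n t = 0 /\ z1 n t = 0,
      (forall j t, (j < M)%N -> nearpt M j t ->
        pbound q0 N 1 (fun n => cabs (z0 n t)) (b0 j)) /\
      ((forall j, 0 <= b0 j) /\ pbound p0 M M%:R b0 (C * X0)) &
      (forall j t, (j < M)%N -> nearpt M j t ->
        pbound q1 N 1 (fun n => cabs (z1 n t)) (b1 j)) /\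
      ((forall j, 0 <= b1 j) /\ pbound p1 M M%:R b1 (C * X1))].
Proof.
move=> p01 p11 q01 q11.
have [C0 [K0 [C00 H0]]] := mixed_majorant p01 q01.
have [C1 [K1 [C10 H1]]] := mixed_majorant p11 q11.
have [D D0 HD] := analytic_cutoff (K0 + K1).
have DD : 0 <= 2 * D by rewrite mulr_ge0// ltW.
have nn (e : \bar R) : (1 <= e)%E -> (0 <= e)%E by exact: le_trans.
exists (2 * D * (C0 + C1)); first by rewrite !mulr_gt0// addr_gt0.
move=> M N a0 a1 A0 A1 X0 X1 G M0 X00 X10 a00 a10 A00 A10 aA0 aA1 AX0 AX1 dG Ga.
have [w0 [b0 [w00 w0K aw0 wb0 [b00 bX0]]]] := H0 M N a0 A0 X0 M0 a00 A00 X00 aA0 AX0.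
have [w1 [b1 [w10 w1K aw1 wb1 [b10 bX1]]]] := H1 M N a1 A1 X1 M0 a10 A10 X10 aA1 AX1.
have /choice[Phi HPhi] n : exists Phi, disc Phi /\ forall t,
    [/\ cabs (Phi t) <= D, cabs (Phi t) * (w0 n t * (w1 n t)^-1) <= D,
        cabs (1 - Phi t) <= D & cabs (1 - Phi t) <= D * (w0 n t * (w1 n t)^-1)].
  have [||Phi dPhi h] := HD (fun t => w0 n t * (w1 n t)^-1); last by exists Phi.
  - by move=> t; rewrite mulr_gt0 ?invr_gt0.
  - by apply: logregM (logregV _ _) => // t; rewrite invr_gt0.
exists (fun n t => G n t * (1 - Phi n t)), (fun n t => G n t * Phi n t).
exists (fun j => 2 * D * b0 j), (fun j => 2 * D * b1 j); split.
- move=> n; have [dP _] := HPhi n.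
  by split; apply: discM => //; exact: discB (disc_cst _) _.
- by move=> n t; ring.
- by move=> n G0 t; rewrite G0 !mul0r.
- split; last split.
  + move=> j t jM tj; have wb := wb0 j t jM tj.
    apply: (@pbound_mono _ _ _ _ _ (fun n => 2 * D * w0 n t)) => //; first exact: nn.
      move=> n nN; rewrite cabs_ge0/= cabsM.
      have [_ /(_ t)[_ _ h1 h2]] := HPhi n.
      have h3 : cabs (G n t) <= w0 n t + w1 n t.
        by apply: (le_trans (Ga j t n jM tj nN)); apply: lerD; [exact: aw0 jM tj nN|exact: aw1 jM tj nN].
      apply: (@le_trans _ _ ((w0 n t + w1 n t) * cabs (1 - Phi n t))).
        by rewrite ler_wpM2r ?cabs_ge0.
      rewrite mulrDl.
      (* For the part of |G_n| below w0 use |1 - Phi| <= D, for the part below w1 use |1 - Phi| <= D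
         w0/w1. Both give D w0, hence the factor 2D; the other piece is symmetric. *)
      have e1 : w0 n t * cabs (1 - Phi n t) <= w0 n t * D by rewrite ler_pM2l.
      have e2 : w1 n t * cabs (1 - Phi n t) <= w0 n t * D.
        rewrite mulrC -ler_pdivlMr//; apply: (le_trans h2).
        by rewrite mulrA [D * _]mulrC.
      lra.
    by apply: pbound_scale => // n; exact: ltW.
  + by move=> j; rewrite mulr_ge0.
  + apply: (@pbound_leX _ _ _ _ _ (2 * D * (C0 * X0))) => //; first exact: nn.
      rewrite mulr_ge0 ?mulr_ge0 ?(ltW C00) ?(ltW X00) ?(ltW D0)//=.
      by rewrite -[leRHS]mulrA ler_wpM2l// ler_pM2r// lerDl ltW.
    by apply: pbound_scale => //; rewrite mulr_ge0 ?(ltW C00) ?(ltW X00).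
- split; last split.
  + move=> j t jM tj; have wb := wb1 j t jM tj.
    apply: (@pbound_mono _ _ _ _ _ (fun n => 2 * D * w1 n t)) => //; first exact: nn.
      move=> n nN; rewrite cabs_ge0/= cabsM.
      have [_ /(_ t)[h1 h2 _ _]] := HPhi n.
      have h3 : cabs (G n t) <= w0 n t + w1 n t.
        by apply: (le_trans (Ga j t n jM tj nN)); apply: lerD; [exact: aw0 jM tj nN|exact: aw1 jM tj nN].
      apply: (@le_trans _ _ ((w0 n t + w1 n t) * cabs (Phi n t))).
        by rewrite ler_wpM2r ?cabs_ge0.
      rewrite mulrDl.
      have e1 : w1 n t * cabs (Phi n t) <= w1 n t * D by rewrite ler_pM2l.
      have e2 : w0 n t * cabs (Phi n t) <= w1 n t * D.
        by move: h2; rewrite mulrA ler_pdivrMr// [cabs _ * _]mulrC [D * _]mulrC.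
      lra.
    by apply: pbound_scale => // n; exact: ltW.
  + by move=> j; rewrite mulr_ge0.
  + apply: (@pbound_leX _ _ _ _ _ (2 * D * (C1 * X1))) => //; first exact: nn.
      rewrite mulr_ge0 ?mulr_ge0 ?(ltW C10) ?(ltW X10) ?(ltW D0)//=.
      by rewrite -[leRHS]mulrA ler_wpM2l// ler_pM2r// lerDr ltW.
    by apply: pbound_scale => //; rewrite mulr_ge0 ?(ltW C10) ?(ltW X10).
Qed.

End AnalyticSplit.

(** * The norm of l_q *)

Section SequenceNorm.
Set Implicit Arguments. Unset Strict Implicit. Unset Printing Implicit Defensive.
Local Open Scope classical_set_scope.
Local Open Scope ring_scope.
Variable R : realType.
Implicit Types (q : \bar R) (a b : nat -> R[i]).
Local Open Scope ereal_scope.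

Lemma le_poweR2 (s : R) (x y : \bar R) : (0 <= s)%R -> 0 <= x -> x <= y ->
  x `^ s <= y `^ s.
Proof.
move=> s0 x0 xy; have y0 := le_trans x0 xy.
by apply: gt0_ler_poweR => //; rewrite in_itv /= ?x0 ?y0 /= leey.
Qed.

Lemma poweRV_le (r X : R) (S : \bar R) : (0 < r)%R -> (0 <= X)%R -> 0 <= S ->
  (S `^ r^-1 <= X%:E) = (S <= (X `^ r)%:E).
Proof.
move=> r0 X0 S0; have r00 : r != 0%R by rewrite gt_eqF.
apply/idP/idP => h.
  have -> : S = (S `^ r^-1) `^ r by rewrite -poweRrM mulVf// poweRe1.
  by rewrite -poweR_EFin; apply: le_poweR2; rewrite ?poweR_ge0 ?(ltW r0).
have -> : X%:E = ((X `^ r)%:E) `^ r^-1.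
  by rewrite -poweR_EFin -poweRrM divff// poweRe1// lee_fin.
by apply: le_poweR2; rewrite ?invr_ge0 ?(ltW r0).
Qed.

(** Bounding x + y by twice the larger term works for every positive exponent, so the lemma applies
    to r and to its inverse alike; together they give the 4 >= 2 * 2^(1/r) of [lq_norm_quasi]. *)
Lemma poweR_quasi (r : R) (x y : \bar R) : (0 < r)%R -> 0 <= x -> 0 <= y ->
  (x + y) `^ r <= (2 `^ r)%:E * (x `^ r + y `^ r).
Proof.
move=> r0; wlog xy : x y / x <= y => [H x0 y0|x0 y0].
  have [xy|/ltW yx] := leP x y; first exact: H.
  by rewrite addeC [x `^ r + _]addeC; exact: H.
have -> : (2 `^ r)%:E = 2%:E `^ r :> \bar R by rewrite poweR_EFin.
apply: (@le_trans _ _ ((2%:E * y) `^ r)).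
  apply: le_poweR2; rewrite ?(ltW r0) ?adde_ge0//.
  by rewrite [X in X%:E * _](_ : 2 = 1 + 1)%R// EFinD ge0_muleDl// mul1e leeD2r.
by rewrite poweRM// lee_wpmul2l ?poweR_ge0// leeDr// poweR_ge0.
Qed.

Definition lq_sum (r : R) a := \sum_(0 <= n <oo) ((cabs (a n) `^ r)%R)%:E.

Lemma lq_sum_ge0 r a : 0 <= lq_sum r a.
Proof. by apply: nneseries_ge0 => n _ _; rewrite lee_fin powR_ge0. Qed.

Lemma lq_normE (r : R) a : lq_norm r%:E a = lq_sum r a `^ r^-1.
Proof. by []. Qed.

Lemma lq_norm_ge0 q a : 0 <= lq_norm q a.
Proof.
case: q => [r| |] //=; first exact: poweR_ge0.
apply: (@le_trans _ _ (cabs (a 0%N))%:E); first by rewrite lee_fin cabs_ge0.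
by apply: ereal_sup_ubound; exists 0%N.
Qed.

Lemma lq_norm_leP (r X : R) a : (0 < r)%R -> (0 <= X)%R ->
  (lq_norm r%:E a <= X%:E) = (lq_sum r a <= (X `^ r)%:E).
Proof. by move=> r0 X0; rewrite lq_normE poweRV_le// lq_sum_ge0. Qed.

Lemma lq_normy_leP (X : \bar R) a :
  (lq_norm +oo a <= X) <-> forall n, (cabs (a n))%:E <= X.
Proof.
split=> [h n|h]; last by apply: ge_ereal_sup => _ [n _ <-].
by apply: le_trans h; apply: ereal_sup_ubound; exists n.
Qed.

Lemma le_lq_norm q a b : 1 <= q -> (forall n, cabs (a n) <= cabs (b n))%R ->
  lq_norm q a <= lq_norm q b.
Proof.
case: q => [r| |]; [move=> q1 ab|move=> _ ab|by []].
  have r0 : (0 < r)%R by move: q1; rewrite lee_fin; exact: lt_le_trans.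
  apply: (@le_poweR2 r^-1 (lq_sum r a) (lq_sum r b)).
  - by rewrite invr_ge0 ltW.
  - exact: lq_sum_ge0.
  apply: lee_nneseries => n _; first by rewrite lee_fin powR_ge0.
  by rewrite lee_fin le_powR2 ?(ltW r0) ?cabs_ge0.
apply/lq_normy_leP => n; apply: (@le_trans _ _ (cabs (b n))%:E).
  by rewrite lee_fin.
by move: n; apply/lq_normy_leP; exact: lexx.
Qed.

Lemma lq_normN q a : 1 <= q -> lq_norm q (fun n => - a n)%R = lq_norm q a.
Proof.
by move=> q1; apply/eqP; rewrite eq_le; apply/andP; split;
  apply: le_lq_norm => // n; rewrite cabsN.
Qed.

Lemma lq_norm_quasi q a b : 1 <= q ->
  lq_norm q (fun n => a n + b n)%R <= 4%:E * (lq_norm q a + lq_norm q b).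
Proof.
case: q => [r| |]// q1; last first.
  apply/lq_normy_leP => n.
  apply: (@le_trans _ _ (lq_norm +oo a + lq_norm +oo b)).
    apply: (@le_trans _ _ ((cabs (a n))%:E + (cabs (b n))%:E)).
      by rewrite -EFinD lee_fin cabsD.
    by apply: leeD; move: n; apply/lq_normy_leP; exact: lexx.
  have s0 : 0 <= lq_norm +oo a + lq_norm +oo b by rewrite adde_ge0 ?lq_norm_ge0.
  rewrite -[leLHS]mul1e; apply: lee_wpmul2r => //.
  by rewrite lee_fin ler1n.
have r1 : (1 <= r)%R by rewrite -lee_fin.
have r0 : (0 < r)%R by exact: lt_le_trans r1.
have r00 : r != 0%R by rewrite gt_eqF.
rewrite !lq_normE.
have le1 : lq_sum r (fun n => a n + b n)%R <=
    (2 `^ r)%:E * (lq_sum r a + lq_sum r b).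
  rewrite /lq_sum -nneseriesD; try by move=> n _ _; rewrite lee_fin powR_ge0.
  rewrite -nneseriesZl ?lee_fin ?powR_ge0//; last first.
    by move=> n _; rewrite adde_ge0// lee_fin powR_ge0.
  apply: lee_nneseries => n _; first by rewrite lee_fin powR_ge0.
  apply: (@le_trans _ _ (((cabs (a n))%:E + (cabs (b n))%:E) `^ r)).
    by rewrite -EFinD poweR_EFin lee_fin le_powR2 ?cabs_ge0 ?cabsD// ltW.
  by rewrite -(poweR_EFin (cabs (a n))) -(poweR_EFin (cabs (b n))); apply: poweR_quasi; rewrite ?lee_fin ?cabs_ge0.
apply: (@le_trans _ _ (((2 `^ r)%:E * (lq_sum r a + lq_sum r b)) `^ r^-1)).
  by apply: le_poweR2; rewrite ?invr_ge0 ?(ltW r0) ?lq_sum_ge0.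
rewrite poweRM ?lee_fin ?powR_ge0 ?adde_ge0 ?lq_sum_ge0//.
rewrite poweR_EFin -powRrM divff// powRr1//.
apply: (@le_trans _ _ (2%:E * ((2 `^ r^-1)%:E * (lq_sum r a `^ r^-1 + lq_sum r b `^ r^-1)))).
  by apply: lee_wpmul2l; rewrite ?lee_fin// poweR_quasi ?invr_gt0 ?lq_sum_ge0.
rewrite muleA -EFinM; apply: lee_wpmul2r; first by rewrite adde_ge0 ?poweR_ge0.
rewrite lee_fin; have -> : (4 = 2 * 2 :> R)%R by ring.
rewrite ler_pM2l//; apply: ler1_powR; rewrite ?ler1n// invf_le1//.
Qed.

Lemma nneseries_finite (f : nat -> \bar R) N : (forall n, 0 <= f n) ->
  (forall n, (N <= n)%N -> f n = 0) ->
  \sum_(0 <= n <oo) f n = \sum_(n < N) f n.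
Proof.
move=> f0 fN; rewrite (@nneseries_split _ _ 0%N N)// add0n eseries0 ?adde0//.
  by rewrite big_mkord.
by move=> i Ni _; exact: fN.
Qed.

Lemma lq_norm_finite q a N (X : R) : 1 <= q -> (0 <= X)%R ->
  (forall n, (N <= n)%N -> a n = 0%R) -> pbound q N 1 (fun n => cabs (a n)) X ->
  lq_norm q a <= X%:E.
Proof.
case: q => [r| |]// q1 X0 aN.
  have r0 : (0 < r)%R by move: q1; rewrite lee_fin; exact: lt_le_trans.
  rewrite lq_norm_leP// /lq_sum (@nneseries_finite _ N).
  - by rewrite /= mul1r -lee_fin sumEFin.
  - by move=> n; rewrite lee_fin powR_ge0.
  - by move=> n /aN ->; rewrite cabs0 powR0 ?gt_eqF.
move=> h; apply/lq_normy_leP => n; rewrite lee_fin.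
by have [/h//|/aN ->] := ltnP n N; rewrite cabs0.
Qed.

Lemma pbound_lq_norm q a N (X : R) : 1 <= q -> (0 <= X)%R ->
  lq_norm q a <= X%:E -> pbound q N 1 (fun n => cabs (a n)) X.
Proof.
case: q => [r| |]// q1 X0.
  have r0 : (0 < r)%R by move: q1; rewrite lee_fin; exact: lt_le_trans.
  rewrite lq_norm_leP//= mul1r -lee_fin => h; apply: le_trans h.
  rewrite -sumEFin -(big_mkord xpredT (fun n => (cabs (a n) `^ r)%:E)).
  by apply: nneseries_lim_ge => n _ _; rewrite lee_fin powR_ge0.
by move/lq_normy_leP => h n _; rewrite -lee_fin.
Qed.

Lemma in_lqD q a b : 1 <= q -> in_lq q a -> in_lq q b ->
  in_lq q (fun n => a n + b n)%R.
Proof.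
move=> q1 [a1 a2] [b1 b2]; split.
  apply: (le_lt_trans (lq_norm_quasi _ _ q1)); rewrite lte_mul_pinfty ?lte_add_pinfty//.
move=> qy; have /cvgr0Pnorm_le A := a2 qy; have /cvgr0Pnorm_le B := b2 qy.
apply/cvgr0Pnorm_le => e e0; have e2 : (0 < e / 2)%R by rewrite divr_gt0.
near=> n; rewrite ger0_norm ?cabs_ge0//; apply: (le_trans (cabsD _ _)).
rewrite [leRHS]splitr; apply: lerD; rewrite -[leLHS]ger0_norm ?cabs_ge0//; near: n.
- exact: A.
- exact: B.
Unshelve. all: by end_near. Qed.

Lemma in_lq_finite q a N : 1 <= q -> (forall n, (N <= n)%N -> a n = 0%R) ->
  in_lq q a.
Proof.
move=> q1 aN; split; last first.
  move=> _; apply/cvgr0Pnorm_le => e e0; near=> n.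
  rewrite aN ?cabs0 ?normr0 ?ltW//; near: n; exact: nbhs_infty_ge.
case: q q1 => [r| |]// q1.
  have r0 : (0 < r)%R by move: q1; rewrite lee_fin; exact: lt_le_trans.
  rewrite lq_normE poweR_lty// /lq_sum (@nneseries_finite _ N).
  - by rewrite sumEFin ltry.
  - by move=> n; rewrite lee_fin powR_ge0.
  - by move=> n /aN ->; rewrite cabs0 powR0 ?gt_eqF.
apply: (@le_lt_trans _ _ (\sum_(n < N) cabs (a n))%R%:E); last exact: ltry.
apply/lq_normy_leP => n; rewrite lee_fin.
have [nN|/aN ->] := ltnP n N; last by rewrite cabs0 sumr_ge0// => i _; exact: cabs_ge0.
rewrite (bigD1 (Ordinal nN))//= lerDl sumr_ge0// => i _; exact: cabs_ge0.
Unshelve. all: by end_near. Qed.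

(** For infinite exponent this is where c_0 replaces l_infinity: a merely bounded sequence has no
    small tails. *)
Lemma lq_tail q a (e : R) : 1 <= q -> in_lq q a -> (0 < e)%R ->
  exists N0, forall N, (N0 <= N)%N ->
    lq_norm q (fun n => if (n < N)%N then 0 else a n)%R <= e%:E.
Proof.
case: q => [r| |]// q1 [a1 a2] e0; last first.
  have /cvgr0Pnorm_le/(_ e e0)[N0 _ H] := a2 erefl.
  exists N0 => N N0N; apply/lq_normy_leP => n; rewrite lee_fin.
  case: ltnP => [_|Nn]; first by rewrite cabs0 ltW.
  by have := H n (leq_trans N0N Nn); rewrite /= ger0_norm ?cabs_ge0.
have r0 : (0 < r)%R by move: q1; rewrite lee_fin; exact: lt_le_trans.
have er : (0 < e `^ r)%R by rewrite powR_gt0.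
have fin : lq_sum r a < +oo.
  by move: a1; rewrite lq_normE; apply: lty_poweRy; rewrite gt_eqF ?invr_gt0.
have := @nneseries_tail_cvg R _ xpredT fin
  ltac:(by move=> n _; rewrite lee_fin powR_ge0).
move=> /fine_cvgP[[N1 _ H1] /cvgr0Pnorm_le/(_ _ er)[N2 _ H2]].
exists (maxn N1 N2) => N; rewrite geq_max => /andP[N1N N2N].
rewrite lq_norm_leP ?(ltW e0)//.
have -> : lq_sum r (fun n => if (n < N)%N then 0 else a n)%R =
    \sum_(N <= n <oo) ((cabs (a n) `^ r)%R)%:E.
  rewrite /lq_sum (@nneseries_split _ _ 0%N N); last by move=> k _; rewrite lee_fin powR_ge0.
  rewrite add0n big_mkord big1 ?add0e => [|i _]; last first.
    by rewrite ltn_ord cabs0 powR0 ?gt_eqF.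
  rewrite eseries_cond [RHS]eseries_cond; apply: eq_eseriesr => n /= Nn.
  by rewrite ltnNge Nn.
have := H2 N N2N; rewrite /= ger0_norm; last first.
  by rewrite fine_ge0//; apply: nneseries_ge0 => n _ _; rewrite lee_fin powR_ge0.
rewrite -lee_fin fineK//; exact: (H1 N N1N).
Qed.

End SequenceNorm.

(** * The norm of L_p(l_q) *)

Section MixedNorm.
Set Implicit Arguments. Unset Strict Implicit. Unset Printing Implicit Defensive.
Local Open Scope classical_set_scope.
Local Open Scope ring_scope.
Variable R : realType.
Implicit Types (p q : \bar R) (F G : R -> nat -> R[i]).
Notation mu := (@lebesgue_measure R).
Notation circ := (@circ R).
Local Open Scope ereal_scope.

Definition cmeas F := forall n,
  measurable_fun circ (fun t => complex.Re (F t n)) /\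
  measurable_fun circ (fun t => complex.Im (F t n)).

Lemma ae_imp (P Q : R -> Prop) : (forall t, P t -> Q t) ->
  {ae mu, forall t, P t} -> {ae mu, forall t, Q t}.
Proof. by move=> PQ; apply: negligibleS => t /= nQ Pt; exact/nQ/PQ. Qed.

Lemma ae_imp2 (P Q S : R -> Prop) : (forall t, P t -> Q t -> S t) ->
  {ae mu, forall t, P t} -> {ae mu, forall t, Q t} -> {ae mu, forall t, S t}.
Proof.
move=> PQS aP aQ; have := negligibleU aP aQ.
apply: negligibleS => t /= nS; apply: contrapT => /not_orP[/contrapT Pt /contrapT Qt].
exact/nS/PQS.
Qed.

Lemma measurable_circ : measurable circ.
Proof. exact: measurable_itv. Qed.

Lemma cmeasD F G : cmeas F -> cmeas G -> cmeas (fun t n => F t n + G t n)%R.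
Proof.
move=> mF mG n; have [f1 f2] := mF n; have [g1 g2] := mG n.
split; [under eq_fun do rewrite cReD|under eq_fun do rewrite cImD];
  exact: measurable_funD.
Qed.

Lemma cmeasN F : cmeas F -> cmeas (fun t n => - F t n)%R.
Proof.
move=> mF n; have [f1 f2] := mF n.
split; [under eq_fun do rewrite cReN|under eq_fun do rewrite cImN];
  exact: measurableT_comp.
Qed.

Lemma measurable_cabs F n : cmeas F -> measurable_fun circ (fun t => cabs (F t n)).
Proof.
move=> /(_ n)[f1 f2]; rewrite /cabs.
apply: (@measurableT_comp _ _ _ _ _ _ (@Num.sqrt R)).
  exact: continuous_measurable_fun (@sqrt_continuous R).
by apply: measurable_funD; apply: measurable_funX.
Qed.

Lemma measurable_lq_norm q F : cmeas F -> measurable_fun circ (fun t => lq_norm q (F t)).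
Proof.
move=> mF; case: q => [r| |] /=; last exact: measurable_cst.
  apply: (@measurableT_comp _ _ _ _ _ _ (fun x => @poweR R x (r^-1)%R) circ
    (fun t => lq_sum r (F t))); first exact: measurable_poweR.
  apply: (@ge0_emeasurable_sum _ _ R circ
    (fun n t => ((cabs (F t n)) `^ r)%:E) xpredT) => [k t _ _|k _].
    by rewrite lee_fin powR_ge0.
  apply/measurable_EFinP; apply: (@measurableT_comp _ _ _ _ _ _ (@powR R ^~ r)).
    exact: measurable_powR.
  exact: measurable_cabs.
have -> : (fun t => ereal_sup [set (cabs (F t n))%:E | n in [set: nat]]) =
  (fun t => esups (fun n => (cabs (F t n))%:E) 0%N).
  apply/funext => t; congr ereal_sup; apply/seteqP; split => [_ [n _ <-]|_ [n _ <-]];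
    by exists n.
apply: (@measurable_fun_esups _ _ R circ (fun n t => (cabs (F t n))%:E)) => n.
by apply/measurable_EFinP; exact: measurable_cabs.
Qed.

Lemma measurable_lq_normX q F (r : R) : cmeas F ->
  measurable_fun circ (fun t => lq_norm q (F t) `^ r).
Proof.
move=> mF; apply: (@measurableT_comp _ _ _ _ _ _ (@poweR R ^~ r)).
  exact: measurable_poweR.
exact: measurable_lq_norm.
Qed.

Lemma Lpq_norm_ge0 p q F : 0 <= Lpq_norm p q F.
Proof.
case: p => [r| |] //=; first exact: poweR_ge0.
apply: le_ereal_inf_tmp => M /= aeM; rewrite leNgt; apply/negP => M0.
(* A negative essential bound would hold at no point, making the circle negligible although it has
   measure 1. *)
have aeF : {ae mu, forall t, ~ circ t}.
  apply: ae_imp aeM => t h ct; have := le_lt_trans (h ct) M0.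
  by rewrite ltNge lq_norm_ge0.
have : mu circ = 0.
  have [N [mN N0 sN]] := aeF.
  apply/eqP; rewrite eq_le measure_ge0 andbT -N0; apply: le_measure.
  - by rewrite inE; exact: measurable_circ.
  - by rewrite inE.
  - by move=> t ct; apply: sN => /=; apply.
by rewrite lebesgue_measure_itv /= lte_fin ltr01 oppr0 adde0 => /eqP; rewrite eqe oner_eq0.
Qed.

Lemma Lpq_norm_leP (r X : R) q F : (0 < r)%R -> (0 <= X)%R ->
  (Lpq_norm r%:E q F <= X%:E) =
  (\int[mu]_(t in circ) (lq_norm q (F t) `^ r) <= (X `^ r)%:E).
Proof.
move=> r0 X0; rewrite [Lpq_norm _ _ _]/= poweRV_le//.
by apply: integral_ge0 => t _; exact: poweR_ge0.
Qed.

(** The slack e spares a proof that the essential supremum is attained. *)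
Lemma Lpq_normy_leP (X : R) q F :
  Lpq_norm +oo q F <= X%:E <-> forall e : R, (0 < e)%R ->
    {ae mu, forall t, circ t -> lq_norm q (F t) <= (X + e)%:E}.
Proof.
split=> [h e e0|h].
  have [|y /= aey yX] := @ereal_inf_lt _ _ (X + e)%:E (le_lt_trans h _).
    by rewrite lte_fin ltrDl.
  by apply: ae_imp aey => t /[apply] /le_trans; apply; exact: ltW.
apply/lee_addgt0Pr => e e0; rewrite -EFinD.
by apply: ereal_inf_lbound => /=; exact: h.
Qed.

Lemma le_Lpq_norm p q F G : 1 <= p -> 1 <= q -> cmeas F -> cmeas G ->
  (forall t n, circ t -> cabs (F t n) <= cabs (G t n))%R ->
  Lpq_norm p q F <= Lpq_norm p q G.
Proof.
move=> p1 q1 mF mG FG.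
have lqFG t : circ t -> lq_norm q (F t) <= lq_norm q (G t).
  by move=> ct; apply: le_lq_norm => // n; exact: FG.
case: p p1 => [r p1|_|]; last by []; last first.
  by apply: ereal_inf_le_tmp => M /=; apply: ae_imp => t h ct; exact: le_trans (lqFG t ct) (h ct).
have r0 : (0 < r)%R by move: p1; rewrite lee_fin; exact: lt_le_trans.
have I0 F' : 0 <= \int[mu]_(t in circ) (lq_norm q (F' t) `^ r).
  by apply: integral_ge0 => t _; exact: poweR_ge0.
apply: (le_poweR2 _ (I0 F)); first by rewrite invr_ge0 ltW.
apply: ge0_le_integral.
- exact: measurable_circ.
- by move=> t _; exact: poweR_ge0.
- exact: measurable_lq_normX.
- exact: measurable_lq_normX.
- by move=> t ct; apply: le_poweR2; rewrite ?(ltW r0) ?lq_norm_ge0 ?lqFG.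
Qed.

(** 16 = 4 * 2 * 2: the factor of [lq_norm_quasi], that of [poweR_quasi] under the integral, and X^r
    + Y^r <= 2 (X + Y)^r. Real bounds X and Y keep infinite values out of the computation. *)
Lemma Lpq_norm_quasi p q F G (X Y : R) : 1 <= p -> 1 <= q -> cmeas F -> cmeas G ->
  (0 <= X)%R -> (0 <= Y)%R ->
  Lpq_norm p q F <= X%:E -> Lpq_norm p q G <= Y%:E ->
  Lpq_norm p q (fun t n => F t n + G t n)%R <= (16 * (X + Y))%:E.
Proof.
move=> p1 q1 mF mG X0 Y0; have XY0 : (0 <= X + Y)%R by rewrite addr_ge0.
case: p p1 => [r| |]// p1; last first.
  move=> /Lpq_normy_leP hF /Lpq_normy_leP hG; apply/Lpq_normy_leP => e e0.
  have e8 : (0 < e / 8)%R by rewrite divr_gt0.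
  apply: ae_imp2 (hF _ e8) (hG _ e8) => t hFt hGt ct.
  apply: (le_trans (lq_norm_quasi _ _ q1)).
  apply: (@le_trans _ _ (4%:E * ((X + e / 8)%:E + (Y + e / 8)%:E))).
    by rewrite lee_wpmul2l ?lee_fin//; apply: leeD; [exact: hFt|exact: hGt].
  by rewrite -EFinD -EFinM lee_fin; lra.
have r1 : (1 <= r)%R by rewrite -lee_fin.
have r0 : (0 < r)%R by exact: lt_le_trans r1.
rewrite (Lpq_norm_leP _ _ r0 X0) (Lpq_norm_leP _ _ r0 Y0) => hF hG.
rewrite Lpq_norm_leP; [|exact: r0|by rewrite mulr_ge0].
have mFr := measurable_lq_normX q r mF; have mGr := measurable_lq_normX q r mG.
apply: (@le_trans _ _ (\int[mu]_(t in circ)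
    ((8 `^ r)%:E * (lq_norm q (F t) `^ r + lq_norm q (G t) `^ r)))).
  apply: ge0_le_integral.
  - exact: measurable_circ.
  - by move=> t _; exact: poweR_ge0.
  - by apply: measurable_lq_normX; exact: cmeasD.
  - by apply: measurable_funeM; exact: emeasurable_funD.
  - move=> t _; apply: (@le_trans _ _ ((4%:E * (lq_norm q (F t) + lq_norm q (G t))) `^ r)).
      by apply: le_poweR2; rewrite ?(ltW r0) ?lq_norm_ge0 ?lq_norm_quasi.
    rewrite poweRM ?adde_ge0 ?lq_norm_ge0// poweR_EFin.
    have -> : 8%R = (4 * 2)%R :> R by ring.
    rewrite powRM// EFinM -muleA lee_wpmul2l ?lee_fin ?powR_ge0//.
    by apply: poweR_quasi; rewrite ?lq_norm_ge0.
rewrite ge0_integralZl_EFin ?powR_ge0//; last 3 first.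
- exact: measurable_circ.
- by move=> t _; rewrite adde_ge0 ?poweR_ge0.
- exact: emeasurable_funD.
rewrite ge0_integralD//; last 3 first.
- exact: measurable_circ.
- by move=> t _; exact: poweR_ge0.
- by move=> t _; exact: poweR_ge0.
apply: (@le_trans _ _ ((8 `^ r)%:E * ((X `^ r)%:E + (Y `^ r)%:E))).
  by rewrite lee_wpmul2l ?lee_fin ?powR_ge0//; apply: leeD.
rewrite -EFinD -EFinM lee_fin.
have -> : (16 = 8 * 2 :> R)%R by ring.
rewrite -mulrA powRM ?mulr_ge0// ler_wpM2l ?powR_ge0// powRM//.
have Xl : (X `^ r <= (X + Y) `^ r)%R by rewrite le_powR2 ?(ltW r0)// lerDl.
have Yl : (Y `^ r <= (X + Y) `^ r)%R by rewrite le_powR2 ?(ltW r0)// lerDr.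
have := powR_ge0 (X + Y) r; have := @le1r_powR R 2 r (ler1n _ 2) r1.
by nra.
Qed.

(** * Partition of the circle into M arcs *)

Definition circle_arc (M j : nat) : set R := `[(j%:R / M%:R)%R, (j.+1%:R / M%:R)%R[%classic.

Section Arcs.
Variable M : nat.
Hypothesis M0 : (0 < M)%N.
Let m0 : (0 < M%:R :> R)%R. Proof. by rewrite ltr0n. Qed.

Lemma arcP j t : circle_arc M j t <-> (j%:R <= t * M%:R < j.+1%:R)%R.
Proof. by rewrite /circle_arc /= in_itv /= ler_pdivrMr// ltr_pdivlMr. Qed.

Lemma arc_inj i j t : circle_arc M i t -> circle_arc M j t -> i = j.
Proof. by move=> /arcP/Num.Theory.truncn_def <- /arcP/Num.Theory.truncn_def <-. Qed.

Lemma arc_cover t : circ t -> exists2 j, (j < M)%N & circle_arc M j t.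
Proof.
rewrite /Defs.circ /= in_itv /= => /andP[t0 t1].
have tM : (0 <= t * M%:R)%R by rewrite mulr_ge0// ltW.
exists (Num.truncn (t * M%:R)); last by apply/arcP; exact: truncn_itv.
rewrite -(ltr_nat R); have /andP[h _] := truncn_itv tM.
by apply: (le_lt_trans h); rewrite -[ltRHS]mul1r ltr_pM2r.
Qed.

Lemma arc_sub j : (j < M)%N -> circle_arc M j `<=` circ.
Proof.
move=> jM t /arcP/andP[h1 h2]; rewrite /Defs.circ /= in_itv /=.
have t0 : (0 <= t * M%:R)%R by apply: le_trans h1.
move: t0; rewrite pmulr_lge0// => -> /=.
rewrite -(ltr_pM2r m0) mul1r; apply: (lt_le_trans h2).
by rewrite ler_nat.
Qed.

Lemma arc_nearpt j t : circle_arc M j t -> nearpt M j t.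
Proof.
move/arcP => /andP[h1 h2]; rewrite /nearpt ger0_norm.
  by rewrite lerBlDr -(ler_pM2r m0) mulrDl mulVf ?divfK ?gt_eqF// addrC natr1 ltW.
by rewrite subr_ge0 ler_pdivrMr.
Qed.

Lemma measurable_arc j : measurable (circle_arc M j).
Proof. exact: measurable_itv. Qed.

Lemma mu_arc j : mu (circle_arc M j) = (M%:R^-1)%:E.
Proof.
rewrite /circle_arc lebesgue_measure_itv /= lte_fin ltr_pM2r ?invr_gt0// ltr_nat ltnSn.
by rewrite -EFinB -mulrBl -natr1 addrC addKr mul1r.
Qed.

Lemma integral_arcs (f : R -> \bar R) : measurable_fun circ f ->
  (forall t, 0 <= f t) ->
  \int[mu]_(t in circ) f t = \sum_(j < M) \int[mu]_(t in circle_arc M j) f t.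
Proof.
move=> mf f0.
have cE : circ = \big[setU/set0]_(j <- iota 0 M) circle_arc M j.
  rewrite -bigcup_seq; apply/seteqP; split=> [t /arc_cover[j jM jt]|t [j /=]].
    by exists j => //=; rewrite mem_iota.
  by rewrite mem_iota add0n => jM; exact: arc_sub.
rewrite cE in mf *; rewrite ge0_integral_bigsetU//.
- by rewrite -(big_mkord xpredT (fun j => \int[mu]_(t in circle_arc M j) f t)) /index_iota subn0.
- by move=> j; exact: measurable_arc.
- exact: iota_uniq.
- by move=> i j _ _ [t [it jt]]; exact: arc_inj it jt.
Qed.

End Arcs.

(** Each arc has measure 1/M, so [pbound p M M%:R] is the L_p bound of the step function with values
    [b j]. *)
Lemma Lpq_norm_arcs p q F M (b : nat -> R) (X : R) : 1 <= p -> (0 < M)%N ->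
  cmeas F -> (0 <= X)%R -> (forall j, 0 <= b j)%R -> pbound p M M%:R b X ->
  (forall j t, (j < M)%N -> circle_arc M j t -> lq_norm q (F t) <= (b j)%:E) ->
  Lpq_norm p q F <= X%:E.
Proof.
move=> p1 M0 mF X0 b0; case: p p1 => [r| |]// p1 bX Fb; last first.
  apply/Lpq_normy_leP => e e0; apply/aeW => t ct.
  have [j jM jt] := arc_cover M0 ct; apply: (le_trans (Fb j t jM jt)).
  by rewrite lee_fin (le_trans (bX j jM))// lerDl ltW.
have r0 : (0 < r)%R by move: p1; rewrite lee_fin; exact: lt_le_trans.
have m0 : (0 < M%:R :> R)%R by rewrite ltr0n.
rewrite Lpq_norm_leP// (integral_arcs M0); last 2 first.
- exact: measurable_lq_normX.
- by move=> t; exact: poweR_ge0.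
apply: (@le_trans _ _ (\sum_(j < M) ((b j `^ r) / M%:R)%:E)); last first.
  by rewrite sumEFin lee_fin -mulr_suml ler_pdivrMr// mulrC.
apply: lee_sum => j _.
apply: (@le_trans _ _ (\int[mu]_(t in circle_arc M j) (b j `^ r)%:E)).
  apply: ge0_le_integral.
  - exact: measurable_arc.
  - by move=> t _; exact: poweR_ge0.
  - exact: (measurable_funS measurable_circ (arc_sub M0 (ltn_ord j))
      (measurable_lq_normX q r mF)).
  - exact: measurable_cst.
  - move=> t jt; rewrite -poweR_EFin; apply: le_poweR2; rewrite ?(ltW r0) ?lq_norm_ge0//.
    exact: Fb.
suff -> : \int[mu]_(t in circle_arc M j) (b j `^ r)%:E = (b j `^ r)%:E * mu (circle_arc M j).
  by rewrite mu_arc// EFinM.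
by apply: integral_cst; exact: measurable_arc.
Qed.

(* By Chebyshev's inequality on each arc. *)
Lemma arc_sampling p q F M (X : R) : 1 <= p -> (0 < M)%N -> cmeas F ->
  (0 < X)%R -> Lpq_norm p q F <= X%:E ->
  exists A : nat -> R, [/\ forall j, (0 < A j)%R, pbound p M M%:R A (4 * X)%R &
    forall j, (j < M)%N -> exists B, [/\ measurable B,
      mu B <= ((3 * M%:R)^-1)%:E &
      forall t, circle_arc M j t -> ~ B t -> lq_norm q (F t) <= (A j)%:E]].
Proof.
move=> p1 M0 mF X0; case: p p1 => [r| |]// p1; last first.
  move=> /Lpq_normy_leP/(_ X X0)[B [mB B0 sB]].
  exists (fun=> 4 * X)%R; split=> //; first by move=> _; rewrite mulr_gt0.
  move=> j jM; exists B; split=> //; first by rewrite B0 lee_fin invr_ge0 mulr_ge0.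
  move=> t jt nBt; apply: contrapT => h; apply: nBt; apply: sB => /= H; apply: h.
  apply: le_trans (H (arc_sub M0 jM jt)) _; rewrite lee_fin.
  by have := X0; lra.
have r1 : (1 <= r)%R by rewrite -lee_fin.
have r0 : (0 < r)%R by exact: lt_le_trans r1.
have m0 : (0 < M%:R :> R)%R by rewrite ltr0n.
have mg := measurable_lq_normX q r mF.
have g0 t : 0 <= lq_norm q (F t) `^ r by exact: poweR_ge0.
have Xr0 : (0 < X `^ r)%R by rewrite powR_gt0.
rewrite Lpq_norm_leP ?(ltW X0)// (integral_arcs M0)//.
pose I (j : nat) := \int[mu]_(t in circle_arc M j) (lq_norm q (F t) `^ r).
have I0 j : 0 <= I j by apply: integral_ge0.
rewrite (_ : \sum_(j < M) _ = \sum_(j < M) I j)// => IX.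
have Ifin j : (j < M)%N -> I j \is a fin_num.
  move=> jM; rewrite ge0_fin_numE//; apply: le_lt_trans (ltry (X `^ r)).
  apply: le_trans IX; rewrite (bigD1 (Ordinal jM))//= leeDl// sume_ge0//.
have IF j : (0 <= fine (I j))%R by exact: fine_ge0.
(* The factor 3 makes the bad set at most a third of the arc, which leaves room for two functions on
   the same arc. The summand X^r keeps [a j] positive; on average a is at most 4 X^r. *)
pose a (j : nat) : R := (3 * M%:R * fine (I j) + X `^ r)%R.
have a0 j : (0 < a j)%R by rewrite ltr_wpDl// mulr_ge0// mulr_ge0// ltW.
exists (fun j => a j `^ r^-1)%R; split.
- by move=> j; rewrite powR_gt0.
- rewrite /=; under eq_bigr do rewrite -powRrM mulVf ?gt_eqF// powRr1 ?(ltW (a0 _))//.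
  rewrite big_split /= sumr_const card_ord -mulr_sumr.
  have sI : (\sum_(j < M) fine (I j) <= X `^ r)%R.
    rewrite -lee_fin -sumEFin; apply: le_trans IX; apply: lee_sum => j _.
    by rewrite fineK// Ifin.
  rewrite powRM ?(ltW X0)//.
  have h4 := @le1r_powR R 4 r (ler1n _ 4) r1.
  rewrite -[(X `^ r *+ M)%R]mulr_natl; move: (\sum_(j < M) fine (I j))%R sI => S sI.
  apply: (@le_trans _ _ (M%:R * (4 * X `^ r)))%R; last first.
    by rewrite ler_pM2l// ler_pM2r.
  have -> : (3 * M%:R * S + M%:R * X `^ r = M%:R * (3 * S + X `^ r))%R by ring.
  rewrite ler_pM2l//; lra.
- move=> j jM.
  exists (circle_arc M j `&` [set t | (a j)%:E <= `|lq_norm q (F t) `^ r|]).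
  have mgj : measurable_fun (circle_arc M j) (fun t => lq_norm q (F t) `^ r).
    exact: (measurable_funS measurable_circ (arc_sub M0 jM) mg).
  split.
  + apply: (emeasurable_fun_c_infty _) => //.
      exact: measurable_arc.
    exact: measurableT_comp.
  + have h : (a j)%:E * mu (circle_arc M j `&` [set t | (a j)%:E <= `|lq_norm q (F t) `^ r|]) <= I j.
      apply: (@le_trans _ _ (\int[mu]_(t in circle_arc M j) `|lq_norm q (F t) `^ r|)).
        by apply: le_integral_abse => //; exact: measurable_arc.
      rewrite le_eqVlt; apply/orP; left; apply/eqP; apply: eq_integral => t _.
      by rewrite gee0_abs.
    rewrite -(fineK (Ifin j jM)) in h.
    rewrite -(@lee_pmul2l _ (a j)%:E)// ?lte_fin//.
    apply: (le_trans h); rewrite -EFinM lee_fin /a.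
    rewrite ler_pdivlMr ?mulr_gt0//.
    by rewrite mulrC lerDl ltW.
  + move=> t jt nB; rewrite leNgt; apply/negP => h; apply: nB; split=> //=.
    rewrite gee0_abs//; have -> : (a j)%:E = ((a j `^ r^-1)%R)%:E `^ r.
      by rewrite poweR_EFin -powRrM mulVf ?gt_eqF// powRr1// ltW.
    by apply: le_poweR2; rewrite ?(ltW r0) ?lee_fin ?powR_ge0 ?(ltW h).
Qed.

End MixedNorm.

(** * Approximation and sampling *)

Section Assembly.
Set Implicit Arguments. Unset Strict Implicit. Unset Printing Implicit Defensive.
Local Open Scope classical_set_scope.
Local Open Scope ring_scope.
Variable R : realType.
Implicit Types (p q : \bar R) (F x y : R -> nat -> R[i]) (G z : nat -> R -> R[i]).
Notation mu := (@lebesgue_measure R).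
Notation circ := (@circ R).

Lemma measurable_expi k : measurable_fun circ (fun t : R => complex.Re (expi k t)) /\
  measurable_fun circ (fun t : R => complex.Im (expi k t)).
Proof.
have ml (c : R) : measurable_fun circ (fun t : R => c * t).
  apply: measurable_funM; [exact: measurable_cst|exact: measurable_id].
split => /=; apply: measurableT_comp (ml (2 * pi * k%:R)).
  exact: continuous_measurable_fun (@continuous_cos R).
exact: continuous_measurable_fun (@continuous_sin R).
Qed.

Lemma measurable_horner_expi (P : {poly R[i]}) :
  measurable_fun circ (fun t => complex.Re P.[expi 1 t]) /\
  measurable_fun circ (fun t => complex.Im P.[expi 1 t]).
Proof.
elim/poly_ind: P => [|P c [IH1 IH2]].
  by under eq_fun do rewrite horner0; under [X in _ /\ measurable_fun _ X]eq_fun do rewrite horner0;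
    split; exact: measurable_cst.
have [m1 m2] := measurable_expi 1.
split.
  under eq_fun do rewrite hornerMXaddC cReD cReM.
  apply: measurable_funD; last exact: measurable_cst.
  by apply: measurable_funB; apply: measurable_funM.
under eq_fun do rewrite hornerMXaddC cImD cImM.
apply: measurable_funD; last exact: measurable_cst.
by apply: measurable_funD; apply: measurable_funM.
Qed.

Lemma measurable_disc (f : R -> R[i]) : disc f ->
  measurable_fun circ (fun t => complex.Re (f t)) /\
  measurable_fun circ (fun t => complex.Im (f t)).
Proof.
move=> df; have /choice[P HP] (k : nat) : exists P : {poly R[i]},
    forall t, cabs (f t - P.[expi 1 t]) <= k.+1%:R^-1.
  by apply: df; rewrite invr_gt0.
have small (e : R) : 0 < e -> \forall k \near \oo, (k.+1%:R^-1 : R) <= e.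
  move=> e0; near=> k; rewrite -[leRHS]invrK lef_pV2 ?posrE ?invr_gt0//.
  apply: (@le_trans _ _ k%:R); last by rewrite ler_nat.
  by near: k; exact: nbhs_infty_ger.
split.
  apply: (@measurable_fun_cvg _ _ R circ (fun k t => complex.Re (P k).[expi 1 t])).
    by move=> k; have [] := measurable_horner_expi (P k).
  move=> t _; apply/cvgrPdist_le => e /small; apply: filterS => k; apply: le_trans.
  by apply: le_trans (HP k t); apply: le_trans (norm_Re_le _); rewrite cReD cReN.
apply: (@measurable_fun_cvg _ _ R circ (fun k t => complex.Im (P k).[expi 1 t])).
  by move=> k; have [] := measurable_horner_expi (P k).
move=> t _; apply/cvgrPdist_le => e /small; apply: filterS => k; apply: le_trans.
by apply: le_trans (HP k t); apply: le_trans (norm_Im_le _); rewrite cImD cImN.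
Unshelve. all: by end_near. Qed.

Lemma cmeas_disc z : (forall n, disc (z n)) -> cmeas (fun t n => z n t).
Proof. by move=> dz n; exact: measurable_disc. Qed.

(** An approximating polynomial is Lipschitz on the circle, by [expr_diff_le] and
    [cabs_expiB_le]. *)
Lemma disc_ucont (f : R -> R[i]) (e : R) : disc f -> 0 < e ->
  exists2 d : R, 0 < d & forall t s, `|t - s| <= d -> cabs (f t - f s) <= e.
Proof.
move=> df e0; have e3 : 0 < e / 3 by rewrite divr_gt0.
have [P HP] := df _ e3.
pose L := 1 + 2 * pi * \sum_(i < size P) cabs P`_i * i%:R.
have S0 : 0 <= \sum_(i < size P) cabs P`_i * i%:R.
  by apply: sumr_ge0 => i _; rewrite mulr_ge0 ?cabs_ge0.
have p0 : 0 <= 2 * pi :> R by rewrite mulr_ge0 ?pi_ge0.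
have L0 : 0 < L by rewrite ltr_pwDl// mulr_ge0.
exists (e / 3 / L) => [|t s ts]; first by rewrite divr_gt0.
have PL : cabs (P.[expi 1 t] - P.[expi 1 s]) <= e / 3.
  apply: (@le_trans _ _ (L * (e / 3 / L))); last by rewrite mulrC divfK// gt_eqF.
  apply: (@le_trans _ _ (L * `|t - s|)); last by rewrite ler_pM2l.
  rewrite !horner_coef -sumrB; apply: (le_trans (cabs_sum_le _ _ _)).
  apply: (@le_trans _ _ ((2 * pi * \sum_(i < size P) cabs P`_i * i%:R) * `|t - s|)); last first.
    by rewrite ler_wpM2r// /L lerDr.
  rewrite mulr_sumr mulr_suml; apply: ler_sum => i _.
  rewrite -mulrBr cabsM.
  have -> : 2 * pi * (cabs P`_i * i%:R) * `|t - s| =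
    cabs P`_i * (i%:R * (2 * pi * `|t - s|)) by ring.
  rewrite ler_wpM2l ?cabs_ge0//; case: (nat_of_ord i) => [|k].
    by rewrite !expr0 subrr cabs0 mul0r.
  apply: (le_trans (@expr_diff_le _ _ _ 1 _ _ _)); rewrite ?cabs_expi//.
  by rewrite expr1n mulr1 ler_pM2l// cabs_expiB_le.
have -> : f t - f s = (f t - P.[expi 1 t]) + (P.[expi 1 t] - P.[expi 1 s]) -
  (f s - P.[expi 1 s]) by ring.
apply: (le_trans (cabsB _ _)).
have := cabsD (f t - P.[expi 1 t]) (P.[expi 1 t] - P.[expi 1 s]).
have := HP t; have := HP s; lra.
Qed.

Local Open Scope ereal_scope.

Lemma Lpq_norm_cst_le p q F (X : R) : 1 <= p -> cmeas F -> (0 <= X)%R ->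
  (forall t, lq_norm q (F t) <= X%:E) -> Lpq_norm p q F <= X%:E.
Proof.
move=> p1 mF X0 FX; apply: (@Lpq_norm_arcs _ p q F 1 (fun=> X)) => //.
by case: p p1 => [r| |] //= _; rewrite big_ord1 mul1r.
Qed.

(** N + 1 dominates N^(1/r) for every r >= 1, and unlike N it can always be divided by. *)
Lemma lq_norm_unif q N (a : nat -> R[i]) (e : R) : 1 <= q -> (0 <= e)%R ->
  (forall n, (N <= n)%N -> a n = 0%R) -> (forall n, (n < N)%N -> (cabs (a n) <= e)%R) ->
  lq_norm q a <= (N.+1%:R * e)%:E.
Proof.
move=> q1 e0 aN ae; apply: (@lq_norm_finite _ _ _ N) => //; first by rewrite mulr_ge0.
case: q q1 => [r| |]//= q1; last first.
  move=> n /ae h; apply: (le_trans h); rewrite -[leLHS]mul1r.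
  by rewrite ler_wpM2r// ler1n.
have r1 : (1 <= r)%R by rewrite -lee_fin.
apply: (@le_trans _ _ (\sum_(n < N) e `^ r))%R.
  by apply: ler_sum => n _; rewrite le_powR2 ?cabs_ge0 ?ae// (le_trans ler01).
rewrite sumr_const card_ord mul1r -[(e `^ r *+ N)%R]mulr_natl powRM// ler_wpM2r ?powR_ge0//.
apply: (@le_trans _ _ N.+1%:R); first by rewrite ler_nat.
by apply: le1r_powR => //; rewrite ler1n.
Qed.

Lemma disc_trig K (b : nat -> R[i]) : disc (fun t => \sum_(k < K) expi k t * b k)%R.
Proof.
apply: disc_sum => k _; apply: discM _ (disc_cst _).
by apply: eq_disc (disc_horner 'X^k) => t; rewrite hornerXn -expiX.
Qed.

Lemma Htilde_trunc p q x (e : R) : 1 <= p -> 1 <= q -> Htilde p q x -> (0 < e)%R ->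
  exists N G, [/\ forall n, disc (G n), forall n t, (N <= n)%N -> G n t = 0%R &
    Lpq_norm p q (fun t n => x t n - G n t)%R <= e%:E].
Proof.
move=> p1 q1 [[mx _] Hx] e0.
have e32 : (0 < e / 32)%R by rewrite divr_gt0.
have [P [[K [b [bq PE]]] xP]] := Hx _ e32.
(* The quasi-triangle inequality is applied once per frequency: 4 (8^k eta + eta) <= 8^(k+1) eta, so
   K tails cost at most 8^K eta = e/32. Then 16 (e/32 + e/32) = e. *)
pose eta := (e / 32 / 8 ^+ K)%R.
have eta0 : (0 < eta)%R by rewrite divr_gt0// exprn_gt0.
have /choice[N0 HN0] k := lq_tail q1 (bq k) eta0.
pose N := (\max_(k < K) N0 k)%N.
pose tl k n := (if (n < N)%N then 0 else b k n)%R.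
have tlle k : (k < K)%N -> lq_norm q (tl k) <= eta%:E.
  by move=> kK; exact: (HN0 k N (@leq_bigmax _ (fun k : 'I_K => N0 k) (Ordinal kK))).
pose T t n := (\sum_(k < K) expi k t * tl k n)%R.
exists N, (fun n t => \sum_(k < K) expi k t * (if (n < N)%N then b k n else 0))%R; split.
- by move=> n; exact: (@disc_trig K (fun k => if (n < N)%N then b k n else 0%R)).
- by move=> n t Nn; rewrite big1// => k _; rewrite ltnNge Nn mulr0.
have -> : (fun t n => x t n - \sum_(k < K) expi k t * (if (n < N)%N then b k n else 0))%R =
  (fun t n => (x t n - P t n) + T t n)%R.
  apply/funext => t; apply/funext => n; rewrite PE /T -addrA; congr (_ + _)%R.
  rewrite -sumrN -sumrN -big_split /=; apply: eq_bigr => k _; rewrite /tl.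
  by case: ifP => _; ring.
have -> : (e = 16 * (e / 32 + e / 32))%R by field.
have mP : cmeas P.
  move=> n; have := measurable_disc (@disc_trig K (b^~ n)).
  by under eq_fun do rewrite -PE; under [X in _ /\ measurable_fun _ X]eq_fun do rewrite -PE.
have mT : cmeas T by apply: (@cmeas_disc (fun n t => T t n)) => n; exact: (@disc_trig K (tl^~ n)).
apply: (Lpq_norm_quasi p1 q1 (cmeasD mx (cmeasN mP)) mT (ltW e32) (ltW e32) (ltW xP)).
apply: (Lpq_norm_cst_le p1 mT (ltW e32)) => t; suff H k : (k <= K)%N ->
    lq_norm q (fun n => \sum_(j < k) expi j t * tl j n)%R <= (8 ^+ k * eta)%:E.
  have := H K (leqnn K); rewrite /eta mulrC divfK// gt_eqF// exprn_gt0//.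
elim: k => [_|k IH kK].
  rewrite expr0 mul1r; apply: (@le_trans _ _ 0); last by rewrite lee_fin ltW.
  apply: (@lq_norm_finite _ _ _ 0) => //; first by move=> n _; rewrite big_ord0.
  by case: (q) => [r| |]//=; rewrite big_ord0 mul1r powR_ge0.
have -> : (fun n => \sum_(j < k.+1) expi j t * tl j n)%R =
  (fun n => \sum_(j < k) expi j t * tl j n + expi k t * tl k n)%R.
  by apply/funext => n; rewrite big_ord_recr.
apply: (le_trans (lq_norm_quasi _ _ q1)).
apply: (@le_trans _ _ (4%:E * ((8 ^+ k * eta)%:E + eta%:E))).
  rewrite lee_wpmul2l ?lee_fin//; apply: leeD; first exact: IH (ltnW kK).
  apply: le_trans (tlle k kK); apply: le_lq_norm => // n.
  by rewrite cabsM cabs_expi mul1r.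
rewrite -EFinD -EFinM lee_fin exprS.
have : (1 <= 8 ^+ k :> R)%R by rewrite exprn_ege1// ler1n.
move: (8 ^+ k)%R => c c1; have : (eta <= c * eta)%R by rewrite ler_peMl// ltW.
by rewrite -[(8 * c * eta)%R]mulrA; lra.
Qed.

(** The cutoffs yield functions of the disc algebra, not polynomials. Approximating finitely many
    coordinates uniformly by polynomials [Q n] shows that they may be added without leaving the
    analytic space. *)
Lemma Htilde_add p q x z N : 1 <= p -> 1 <= q -> Htilde p q x ->
  (forall n, disc (z n)) -> (forall n t, (N <= n)%N -> z n t = 0%R) ->
  Htilde p q (fun t n => x t n + z n t)%R.
Proof.
move=> p1 q1 [[mx [xq xfin]] Hx] dz zN; have mz := cmeas_disc dz.
have near_z (e : R) : (0 < e)%R -> exists Q : nat -> {poly R[i]},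
    (forall n, (N <= n)%N -> Q n = 0%R) /\
    forall t, lq_norm q (fun n => z n t - (Q n).[expi 1 t])%R <= e%:E.
  move=> e0; have eN : (0 < e / N.+1%:R)%R by rewrite divr_gt0.
  have /choice[Q HQ] n := dz n _ eN.
  exists (fun n => if (n < N)%N then Q n else 0%R); split.
    by move=> n Nn; rewrite ltnNge Nn.
  move=> t; have -> : e = (N.+1%:R * (e / N.+1%:R))%R by rewrite mulrC divfK.
  apply: lq_norm_unif => //; first exact: ltW.
    by move=> n Nn; rewrite ltnNge Nn /= horner0 subr0 zN.
  by move=> n nN; rewrite nN.
split; first (split; last split).
- exact: cmeasD.
- apply: ae_imp xq => t xt ct; apply: in_lqD => //; first exact: xt.
  by apply: (@in_lq_finite _ _ _ N) => // n Nn; exact: zN.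
- have [Q [QN HQ]] := near_z 1%R ltr01.
  pose B := (\sum_(n < N) projT1 (cid2 (disc_bounded (dz n))))%R.
  have B0 : (0 <= B)%R.
    by apply: sumr_ge0 => n _; case: cid2 => /= c c0 _; exact: ltW.
  have zB t n : (n < N)%N -> (cabs (z n t) <= B)%R.
    move=> nN; rewrite /B (bigD1 (Ordinal nN))//=.
    rewrite -[leLHS]addr0; apply: lerD; first by case: cid2 => /= c c0.
    by apply: sumr_ge0 => i _; case: cid2 => /= c c0 _; exact: ltW.
  have zfin : Lpq_norm p q (fun t n => z n t) <= (N.+1%:R * B)%:E.
    apply: Lpq_norm_cst_le => //; first by rewrite mulr_ge0.
    by move=> t; apply: lq_norm_unif => // n nN; [exact: zN|exact: zB].
  apply: (@le_lt_trans _ _ (16 * (fine (Lpq_norm p q x) + N.+1%:R * B))%:E); last exact: ltry.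
  have n0 := Lpq_norm_ge0 p q x.
  apply: (Lpq_norm_quasi p1 q1 mx mz (fine_ge0 n0) _ _ zfin); first by rewrite mulr_ge0.
  by rewrite fineK// ge0_fin_numE.
(* 16 (e/64 + e/64) = e/2 leaves the strict inequality that [Htilde] demands. *)
move=> e e0; have e64 : (0 < e / 64)%R by rewrite divr_gt0.
have [P [[K [b [bq PE]]] xP]] := Hx _ e64.
have [Q [QN HQ]] := near_z _ e64.
have mP : cmeas P.
  move=> n; have := measurable_disc (@disc_trig K (b^~ n)).
  by under eq_fun do rewrite -PE; under [X in _ /\ measurable_fun _ X]eq_fun do rewrite -PE.
pose L := maxn K (\max_(n < N) size (Q n)).
pose b' k n := ((if (k < K)%N then b k n else 0) + (Q n)`_k)%R.
have sQ n : (size (Q n) <= L)%N.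
  have [nN|/QN ->] := ltnP n N; last by rewrite size_poly0.
  rewrite leq_max; apply/orP; right; exact: (@leq_bigmax _ (fun n : 'I_N => size (Q n)) (Ordinal nN)).
have trigE t n : (P t n + (Q n).[expi 1 t] = \sum_(k < L) expi k t * b' k n)%R.
  under eq_bigr do rewrite /b' mulrDr.
  rewrite big_split /=; congr (_ + _)%R.
    rewrite PE (big_ord_widen L (fun k => expi k t * b k n)%R) ?leq_maxl//.
    rewrite big_mkcond /=; apply: eq_bigr => k _; case: ifP => // _.
    by rewrite mulr0.
  by rewrite (horner_coef_wide _ (sQ n)); apply: eq_bigr => k _; rewrite -expiX mulrC.
exists (fun t n => P t n + (Q n).[expi 1 t])%R; split.
  exists L, b'; split; last exact: trigE.
  move=> k; apply: in_lqD => //.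
    by case: (k < K)%N; [exact: bq|exact: (@in_lq_finite _ _ _ 0)].
  by apply: (@in_lq_finite _ _ _ N) => // n Nn; rewrite QN// coef0.
have -> : (fun t n => x t n + z n t - (P t n + (Q n).[expi 1 t]))%R =
  (fun t n => (x t n - P t n) + (z n t - (Q n).[expi 1 t]))%R.
  by apply/funext => t; apply/funext => n; ring.
have mzQ : cmeas (fun t n => z n t - (Q n).[expi 1 t])%R.
  apply: (@cmeas_disc (fun n t => z n t - (Q n).[expi 1 t])%R) => n.
  by apply: discB => //; exact: disc_horner.
apply: (@le_lt_trans _ _ (16 * (e / 64 + e / 64))%:E); last by rewrite lte_fin; lra.
apply: (Lpq_norm_quasi p1 q1 (cmeasD mx (cmeasN mP)) mzQ (ltW e64) (ltW e64) (ltW xP)).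
exact: (Lpq_norm_cst_le p1 mzQ (ltW e64)).
Qed.

Lemma pbound_addc p M (A : nat -> R) (X c : R) : 1 <= p -> (0 <= X)%R -> (0 <= c)%R ->
  (forall j, 0 <= A j)%R -> pbound p M M%:R A X ->
  pbound p M M%:R (fun j => A j + c)%R (4 * (X + c))%R.
Proof.
move=> p1 X0 c0 A0; case: p p1 => [r| |]//= p1 AX; last first.
  by move=> n /AX; lra.
have r1 : (1 <= r)%R by rewrite -lee_fin.
have r0 : (0 < r)%R by exact: lt_le_trans r1.
have Xc0 : (0 <= X + c)%R by rewrite addr_ge0.
have q2 (u v : R) : (0 <= u)%R -> (0 <= v)%R ->
    ((u + v) `^ r <= 2 `^ r * (u `^ r + v `^ r))%R.
  move=> u0 v0; rewrite -lee_fin EFinM EFinD -!poweR_EFin EFinD.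
  by rewrite [2%:E `^ r]poweR_EFin; apply: poweR_quasi; rewrite ?lee_fin.
apply: (@le_trans _ _ (\sum_(j < M) 2 `^ r * (A j `^ r + c `^ r)))%R.
  by apply: ler_sum => j _; exact: q2.
rewrite -mulr_sumr big_split /= sumr_const card_ord -[(c `^ r *+ M)%R]mulr_natl.
have XX : (X `^ r <= (X + c) `^ r)%R by rewrite le_powR2 ?(ltW r0)// lerDl.
have cX : (c `^ r <= (X + c) `^ r)%R by rewrite le_powR2 ?(ltW r0)// lerDr.
have -> : (4 = 2 * 2 :> R)%R by ring.
rewrite powRM ?mulr_ge0// powRM// -[(2 `^ r * 2 `^ r * _)%R]mulrA.
rewrite [leRHS]mulrCA ler_wpM2l ?powR_ge0//.
apply: (@le_trans _ _ (M%:R * (2 * (X + c) `^ r)))%R.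
  apply: (@le_trans _ _ (M%:R * X `^ r + M%:R * c `^ r))%R; first by rewrite lerD2r.
  by rewrite -mulrDr ler_wpM2l//; lra.
rewrite ler_wpM2l// ler_wpM2r ?powR_ge0//.
by apply: le1r_powR => //; rewrite ler1n.
Qed.

(** The y_i are only measurable and are never smoothed. They are read at one good point of each arc,
    and the uniform continuity of G spreads the resulting bound over the arc. *)
Lemma polynomial_split (p0 p1 q0 q1 : \bar R) :
  1 <= p0 -> 1 <= p1 -> 1 <= q0 -> 1 <= q1 ->
  exists2 C : R, (0 < C)%R & forall N G y0 y1 (X0 X1 : R),
  (forall n, disc (G n)) -> (forall n t, (N <= n)%N -> G n t = 0%R) ->
  cmeas y0 -> cmeas y1 -> (0 < X0)%R -> (0 < X1)%R ->
  Lpq_norm p0 q0 y0 <= X0%:E -> Lpq_norm p1 q1 y1 <= X1%:E ->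
  {ae mu, forall t, circ t -> forall n, G n t = (y0 t n + y1 t n)%R} ->
  exists z0 z1, [/\ forall n, disc (z0 n) /\ disc (z1 n),
     forall n t, G n t = (z0 n t + z1 n t)%R,
     forall n t, (N <= n)%N -> z0 n t = 0%R /\ z1 n t = 0%R,
     Lpq_norm p0 q0 (fun t n => z0 n t) <= (C * X0)%:E &
     Lpq_norm p1 q1 (fun t n => z1 n t) <= (C * X1)%:E].
Proof.
move=> p01 p11 q01 q11; have [C C0 HC] := analytic_split p01 p11 q01 q11.
(* Sampling gives 4X, adding m gives 4 (4X + m) by [pbound_addc], and the l_q quasi-triangle
   inequality gives another 4; as m <= X, the total is at most 80X. *)
exists (C * 80)%R; first by rewrite mulr_gt0.
move=> N G y0 y1 X0 X1 dG GN my0 my1 X00 X10 yX0 yX1 aeG.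
(* An error e in each of N coordinates costs at most m in the l_q norm, which both X0 and X1
   absorb. *)
pose m := Num.min X0 X1; have m0 : (0 < m)%R by rewrite lt_min X00.
pose e := (m / N.+1%:R)%R; have e0 : (0 < e)%R by rewrite divr_gt0.
have eN : (N.+1%:R * e = m)%R by rewrite /e mulrC divfK.
have [d d0 Hd] : exists2 d : R, (0 < d)%R & forall n t s, (n < N)%N ->
    (`|t - s| <= d)%R -> (cabs (G n t - G n s) <= e)%R.
  elim: (N) => [|k [d d0 IH]]; first by exists 1%R.
  have [d' d'0 Hd'] := disc_ucont (dG k) e0.
  exists (Num.min d d') => [|n t s]; first by rewrite lt_min d0.
  rewrite ltnS leq_eqVlt le_min => /orP[/eqP ->|nk] /andP[td td'].
    exact: Hd'.
  exact: IH.
(* Both t and the sample point lie within 1/M of the grid point, so 2/M <= d is the mesh needed. *)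
pose M := (Num.truncn (2 / d)).+1.
have M0 : (0 < M)%N by [].
have Mr0 : (0 < M%:R :> R)%R by rewrite ltr0n.
have Md : (2 / M%:R <= d)%R.
  rewrite ler_pdivrMr// mulrC -ler_pdivrMr//; apply/ltW; exact: truncnS_gt.
have [A0 [A00 AX0 HA0]] := arc_sampling p01 M0 my0 X00 yX0.
have [A1 [A10 AX1 HA1]] := arc_sampling p11 M0 my1 X10 yX1.
have /choice[s Hs] (j : nat) : exists s : R, (j < M)%N -> [/\ circle_arc M j s,
    forall n, G n s = (y0 s n + y1 s n)%R,
    lq_norm q0 (y0 s) <= (A0 j)%:E & lq_norm q1 (y1 s) <= (A1 j)%:E].
  have [jM|Mj] := ltnP j M; last by exists 0%R.
  have [B0 [mB0 muB0 HB0]] := HA0 j jM; have [B1 [mB1 muB1 HB1]] := HA1 j jM.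
  have [B2 [mB2 muB2 HB2]] := aeG.
  (* Two bad sets of measure at most 1/(3M) and a null set cannot cover an arc of measure 1/M. *)
  have : ~ (circle_arc M j `<=` B0 `|` B1 `|` B2).
    move=> sub; have : mu (circle_arc M j) <= ((3 * M%:R)^-1 + (3 * M%:R)^-1)%:E.
      apply: (@le_trans _ _ (mu (B0 `|` B1 `|` B2))).
        by apply: le_measure; rewrite ?inE//; [exact: measurable_arc|apply: measurableU => //; exact: measurableU].
      apply: (@le_trans _ _ (mu (B0 `|` B1) + mu B2)).
        by apply: measureU2 => //; exact: measurableU.
      rewrite muB2 adde0; apply: (@le_trans _ _ (mu B0 + mu B1)); first exact: measureU2.
      by rewrite EFinD; exact: leeD.
    rewrite mu_arc// lee_fin invfM.
    have : (0 < M%:R^-1 :> R)%R by rewrite invr_gt0.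
    lra.
  move=> /existsNP[s /not_implyP[js nB]]; exists s => _.
  have [nB01 nB2] : ~ (B0 `|` B1) s /\ ~ B2 s by split=> h; apply: nB; [left|right].
  split=> //.
  - move=> n; apply: contrapT => h; apply: nB2; apply: HB2 => /= H; apply: h.
    exact: H (arc_sub M0 jM js) n.
  - by apply: HB0 => // h; apply: nB01; left.
  - by apply: HB1 => // h; apply: nB01; right.
(* Adding e absorbs the oscillation of G between t and the sample point, and makes the majorant
   strictly positive. *)
pose a (y : R -> nat -> R[i]) n j : R := (cabs (y (s j) n) + e)%R.
have a_gt0 y n j : (0 < a y n j)%R by rewrite ltr_wpDl ?cabs_ge0.
have aA (q : \bar R) y (A : nat -> R) j : 1 <= q -> (0 < A j)%R ->
    lq_norm q (y (s j)) <= (A j)%:E ->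
    pbound q N 1 ((a y)^~ j) (4 * (A j + m))%R.
  move=> hq Aj yA.
  have Am0 : (0 <= 4 * (A j + m))%R by rewrite mulr_ge0// addr_ge0// ltW.
  apply: (@pbound_mono _ _ _ _ _ (fun n => cabs (rc (cabs (y (s j) n)) +
      (if (n < N)%N then rc e else 0)))%R); first exact: le_trans hq.
    move=> n nN; apply/andP; split; first exact: ltW (a_gt0 _ _ _).
    by rewrite nN -rcD cabs_ge0_rc; [exact: lexx|exact: ltW (a_gt0 _ _ _)].
  apply: pbound_lq_norm => //.
  apply: (le_trans (lq_norm_quasi _ _ hq)).
  rewrite [(4 * _)%R%:E]EFinM lee_wpmul2l ?lee_fin// EFinD; apply: leeD.
    apply: le_trans yA; apply: le_lq_norm => // n.
    by rewrite cabs_ge0_rc ?cabs_ge0.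
  rewrite -eN; apply: lq_norm_unif => //; first exact: ltW.
    by move=> n Nn; rewrite ltnNge Nn.
  by move=> n nN; rewrite nN cabs_ge0_rc// ltW.
have mX0 : (m <= X0)%R by rewrite ge_min lexx.
have mX1 : (m <= X1)%R by rewrite ge_min lexx orbT.
have AX (p : \bar R) (A : nat -> R) (X : R) : 1 <= p -> (forall j, 0 < A j)%R ->
    (0 < X)%R -> (m <= X)%R -> pbound p M M%:R A (4 * X)%R ->
    pbound p M M%:R (fun j => 4 * (A j + m))%R (80 * X)%R.
  move=> hp Ap Xp mX AX.
  apply: (@pbound_leX _ _ _ _ _ (4 * (4 * (4 * X + m)))%R) => //.
  - exact: le_trans hp.
  - apply/andP; split; first by rewrite !mulr_ge0// addr_ge0 ?mulr_ge0// ltW.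
    lra.
  apply: pbound_scale => //.
  - by move=> j; rewrite addr_ge0// ltW.
  - by rewrite mulr_ge0// addr_ge0 ?mulr_ge0// ltW.
  - apply: pbound_addc => //; [by rewrite mulr_ge0// ltW|exact: ltW|by move=> j; exact: ltW].
have [||||||||||||z0 [z1 [b0 [b1 [dz Gz z_0 [zb0 [b00 bX0]] [zb1 [b10 bX1]]]]]]] :=
  HC M N (a y0) (a y1) (fun j => 4 * (A0 j + m))%R (fun j => 4 * (A1 j + m))%R
     (80 * X0)%R (80 * X1)%R G M0.
- by rewrite mulr_gt0.
- by rewrite mulr_gt0.
- exact: a_gt0.
- exact: a_gt0.
- by move=> j; rewrite mulr_gt0// addr_gt0.
- by move=> j; rewrite mulr_gt0// addr_gt0.
- by move=> j jM; have [_ _ h _] := Hs j jM; exact: aA.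
- by move=> j jM; have [_ _ _ h] := Hs j jM; exact: aA.
- exact: AX.
- exact: AX.
- exact: dG.
- move=> j t n jM tj nN; have [sj Gs _ _] := Hs j jM.
  have ts : (`|t - s j| <= d)%R.
    apply: le_trans Md; have := arc_nearpt M0 sj; rewrite /nearpt distrC => h.
    apply: (le_trans (ler_distD (j%:R / M%:R)%R _ _)).
    by move: tj h; rewrite /nearpt; lra.
  have := Hd n t (s j) nN ts; have := cabs_lerB (G n t) (G n (s j)).
  have := cabsD (y0 (s j) n) (y1 (s j) n); rewrite -Gs /a; lra.
exists z0, z1; split=> //.
- by move=> n t Nn; apply: z_0 => t'; exact: GN.
- rewrite -mulrA; apply: (@Lpq_norm_arcs _ _ _ _ M b0) => //.
  + by apply: cmeas_disc => n; case: (dz n).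
  + by rewrite !mulr_ge0// ltW.
  + move=> j t jM jt; apply: (@lq_norm_finite _ _ _ N) => //.
      by move=> n Nn; have [] := z_0 n (fun t' => GN n t' Nn) t.
    by apply: zb0 => //; exact: arc_nearpt.
- rewrite -mulrA; apply: (@Lpq_norm_arcs _ _ _ _ M b1) => //.
  + by apply: cmeas_disc => n; case: (dz n).
  + by rewrite !mulr_ge0// ltW.
  + move=> j t jM jt; apply: (@lq_norm_finite _ _ _ N) => //.
      by move=> n Nn; have [] := z_0 n (fun t' => GN n t' Nn) t.
    by apply: zb1 => //; exact: arc_nearpt.
Qed.

End Assembly.

(** * From finitely many coordinates to the K-functionals *)

Section KClosed.
Set Implicit Arguments. Unset Strict Implicit. Unset Printing Implicit Defensive.
Local Open Scope classical_set_scope.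
Local Open Scope ring_scope.
Local Open Scope ereal_scope.
Variable R : realType.
Implicit Types (p q : \bar R) (F x y : R -> nat -> R[i]).

Lemma Lpq_normN p q F : 1 <= p -> 1 <= q -> cmeas F ->
  Lpq_norm p q (fun t n => - F t n)%R <= Lpq_norm p q F.
Proof.
move=> p1 q1 mF; apply: le_Lpq_norm => //; first exact: cmeasN.
by move=> t n _; rewrite cabsN.
Qed.

(** The norms of x0 and x1 are not controlled by K_t, so they may not enter the estimate; only their
    approximability by G0 and G1 does. With r_i = x_i - G_i small, G0 + G1 = (y0 - r0) + (y1 - r1)
    is split analytically as z0 + z1, and the errors are returned: x = (r0 + z0) + (r1 + z1). The
    pieces are analytic because r_i + z_i = x_i + (z_i - G_i). *)
Lemma Kfun_Htilde_le (p0 p1 q0 q1 : \bar R) :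
  1 <= p0 -> 1 <= p1 -> 1 <= q0 -> 1 <= q1 ->
  exists2 D : R, (0 < D)%R & forall (t : R) x x0 x1 y0 y1, (0 < t)%R ->
    Htilde p0 q0 x0 -> Htilde p1 q1 x1 -> aeq_circ x (fun s n => x0 s n + x1 s n)%R ->
    Lpq p0 q0 y0 -> Lpq p1 q1 y1 -> aeq_circ x (fun s n => y0 s n + y1 s n)%R ->
    Kfun p0 q0 p1 q1 (Htilde p0 q0) (Htilde p1 q1) t x <=
      D%:E * (Lpq_norm p0 q0 y0 + t%:E * Lpq_norm p1 q1 y1).
Proof.
move=> p01 p11 q01 q11; have [C C0 HC] := polynomial_split p01 p11 q01 q11.
(* The inner 16 comes from the norm of y_i - r_i, the outer one from that of r_i + z_i. *)
pose D : R := (16 * (1 + 16 * C))%R; have D0 : (0 < D)%R by rewrite /D; lra.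
exists D => // t x x0 x1 y0 y1 t0 Hx0 Hx1 xE Ly0 Ly1 yE.
have fin p q y : Lpq p q y -> exists2 Y : R, (0 <= Y)%R & Lpq_norm p q y = Y%:E.
  move=> [_ [_ fy]]; exists (fine (Lpq_norm p q y)).
    by rewrite fine_ge0// Lpq_norm_ge0.
  by rewrite fineK// ge0_fin_numE// Lpq_norm_ge0.
have [Y0 Y00 nY0] := fin _ _ _ Ly0; have [Y1 Y10 nY1] := fin _ _ _ Ly1.
rewrite nY0 nY1 -[leRHS]/((D * (Y0 + t * Y1))%:E); apply/lee_addgt0Pr => eps eps0.
have t1 : (0 < 1 + t)%R by rewrite addr_gt0.
(* The total error is D (e + t e) = eps; e may depend on t since D does not. *)
pose e : R := (eps / (D * (1 + t)))%R.
have e0 : (0 < e)%R by rewrite divr_gt0// mulr_gt0.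
have eE : (D * (1 + t) * e = eps)%R by rewrite /e mulrC divfK// gt_eqF// mulr_gt0.
have [N0 [G0 [dG0 G0N nG0]]] := Htilde_trunc p01 q01 Hx0 e0.
have [N1 [G1 [dG1 G1N nG1]]] := Htilde_trunc p11 q11 Hx1 e0.
have [[mx0 _] _] := Hx0; have [[mx1 _] _] := Hx1.
have [my0 _] := Ly0; have [my1 _] := Ly1.
have mxG x' G : cmeas x' -> (forall n, disc (G n)) -> cmeas (fun s n => x' s n - G n s)%R.
  by move=> mx dG; apply: cmeasD => //; apply: cmeasN; exact: cmeas_disc.
pose r0 s n := (x0 s n - G0 n s)%R; pose r1 s n := (x1 s n - G1 n s)%R.
have mr0 : cmeas r0 by exact: mxG. have mr1 : cmeas r1 by exact: mxG.
have mN0 : cmeas (fun s n => - r0 s n)%R by exact: cmeasN.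
have mN1 : cmeas (fun s n => - r1 s n)%R by exact: cmeasN.
have X0gt0 : (0 < 16 * (Y0 + e))%R by rewrite mulr_gt0// ltr_wpDl.
have X1gt0 : (0 < 16 * (Y1 + e))%R by rewrite mulr_gt0// ltr_wpDl.
have [|||||||||z0 [z1 [dz Gz zN nz0 nz1]]] := HC (maxn N0 N1) (fun n s => G0 n s + G1 n s)%R
  (fun s n => y0 s n + - r0 s n)%R (fun s n => y1 s n + - r1 s n)%R
  (16 * (Y0 + e))%R (16 * (Y1 + e))%R.
- by move=> n; exact: discD.
- by move=> n s; rewrite geq_max => /andP[h0 h1]; rewrite G0N// G1N// addr0.
- exact: cmeasD.
- exact: cmeasD.
- exact: X0gt0.
- exact: X1gt0.
- apply: (Lpq_norm_quasi p01 q01 my0 mN0 Y00 (ltW e0)); first by rewrite nY0.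
  exact: le_trans (Lpq_normN p01 q01 mr0) nG0.
- apply: (Lpq_norm_quasi p11 q11 my1 mN1 Y10 (ltW e0)); first by rewrite nY1.
  exact: le_trans (Lpq_normN p11 q11 mr1) nG1.
- apply: ae_imp2 xE yE => s h1 h2 cs n; rewrite /r0 /r1.
  have := congr1 (fun f => f n) (h1 cs); rewrite /= (h2 cs) => h.
  have -> : (G0 n s + G1 n s = (x0 s n + x1 s n) - (x0 s n - G0 n s) - (x1 s n - G1 n s))%R by ring.
  by rewrite -h; ring.
have norm_le p q r (z : nat -> R -> R[i]) Y : 1 <= p -> 1 <= q -> cmeas r ->
    (forall n, disc (z n)) -> (0 <= Y)%R -> Lpq_norm p q r <= e%:E ->
    Lpq_norm p q (fun s n => z n s) <= (C * (16 * (Y + e)))%:E ->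
    Lpq_norm p q (fun s n => r s n + z n s)%R <= (D * (Y + e))%:E.
  move=> hp hq mr dzz Yge nr nz.
  apply: (@le_trans _ _ (16 * (e + C * (16 * (Y + e))))%:E).
    apply: (Lpq_norm_quasi hp hq mr (cmeas_disc dzz) (ltW e0) _ nr nz).
    by rewrite !mulr_ge0 ?addr_ge0// ltW.
  rewrite lee_fin /D; have := mulr_ge0 (ltW C0) Yge; have := mulr_ge0 (ltW C0) (ltW e0).
  by move: e0 Yge; nra.
have HH p q x' G z : 1 <= p -> 1 <= q -> Htilde p q x' ->
    (forall n, disc (G n)) -> (forall n, disc (z n)) ->
    (forall n s, (maxn N0 N1 <= n)%N -> G n s = 0%R) ->
    (forall n s, (maxn N0 N1 <= n)%N -> z n s = 0%R) ->
    Htilde p q (fun s n => (x' s n - G n s) + z n s)%R.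
  move=> hp hq Hx dG dzz GN zzN.
  have -> : (fun s n => (x' s n - G n s) + z n s)%R = (fun s n => x' s n + (z n s - G n s))%R.
    by apply/funext => s; apply/funext => n; ring.
  apply: (@Htilde_add _ p q x' (fun n s => z n s - G n s)%R (maxn N0 N1)) => //.
    by move=> n; exact: discB.
  by move=> n s h; rewrite GN// zzN// subrr.
have dz0 n : disc (z0 n) by case: (dz n). have dz1 n : disc (z1 n) by case: (dz n).
apply: (@le_trans _ _ (Lpq_norm p0 q0 (fun s n => r0 s n + z0 n s)%R +
    t%:E * Lpq_norm p1 q1 (fun s n => r1 s n + z1 n s)%R)).
  apply: ereal_inf_lbound.
  exists (fun s n => r0 s n + z0 n s)%R, (fun s n => r1 s n + z1 n s)%R; split; [|split; [|split]].
  - apply: HH => //.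
      by move=> n s; rewrite geq_max => /andP[h0 h1]; rewrite G0N.
    by move=> n s h; have [] := zN n s h.
  - apply: HH => //.
      by move=> n s; rewrite geq_max => /andP[h0 h1]; rewrite G1N.
    by move=> n s h; have [] := zN n s h.
  - apply: ae_imp xE => s h cs; rewrite (h cs); apply/funext => n; rewrite /r0 /r1.
    have -> : (x0 s n - G0 n s + z0 n s + (x1 s n - G1 n s + z1 n s) =
      x0 s n + x1 s n - (G0 n s + G1 n s) + (z0 n s + z1 n s))%R by ring.
    by rewrite -Gz; ring.
  - by [].
apply: (@le_trans _ _ ((D * (Y0 + e))%:E + t%:E * (D * (Y1 + e))%:E)).
  apply: leeD; first exact: norm_le.
  by rewrite lee_wpmul2l ?lee_fin ?(ltW t0)//; exact: norm_le.
rewrite -[leLHS]/((D * (Y0 + e) + t * (D * (Y1 + e)))%:E) -EFinD lee_fin -eE le_eqVlt; apply/orP; left; apply/eqP; ring.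
Qed.

End KClosed.

Theorem theorem3p1 (R : realType) (p0 p1 q0 q1 : \bar R) :
  (1 <= p0)%E -> (1 <= p1)%E -> (1 <= q0)%E -> (1 <= q1)%E ->
  exists C : R, forall t : R, 0 < t ->
    forall x : R -> nat -> R[i],
      (exists x0 x1, Htilde p0 q0 x0 /\ Htilde p1 q1 x1 /\
                     aeq_circ x (fun s n => x0 s n + x1 s n)) ->
      (Kfun p0 q0 p1 q1 (Htilde p0 q0) (Htilde p1 q1) t x
        <= C%:E * Kfun p0 q0 p1 q1 (Lpq p0 q0) (Lpq p1 q1) t x)%E.
Proof.
move=> p01 p11 q01 q11; have [D D0 HD] := Kfun_Htilde_le p01 p11 q01 q11.
exists D => t t0 x [x0 [x1 [Hx0 [Hx1 xE]]]].
rewrite -lee_pdivrMl//; apply: le_ereal_inf_tmp => _ [y0 [y1 [Ly0 [Ly1 [yE ->]]]]].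
by rewrite lee_pdivrMl//; exact: HD Hx0 Hx1 xE Ly0 Ly1 yE.
Qed.
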